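(* Work in $\mathsf{ZF}$. (a) Let $X$ be a set and $\lambda$ a cardinal such that $\aleph(X)\leq\operatorname{cf}(\lambda)<\aleph^\ast(X)$. Then there is a set $Y$ with $\aleph(Y)=\lambda$ and $\aleph^\ast(Y)=\aleph^\ast(X)\times\lambda^+$. (b) Let $X$ be a set such that $\mu=\aleph(X)$ is singular or a limit cardinal, and let $\lambda$ be a cardinal with $\lambda\geq\sup\{\aleph(\alpha^\alpha)\mid\alpha<\mu\}$ and $\operatorname{cf}(\lambda)=\operatorname{cf}(\mu)$. Then there is a set $Y$ with $\aleph(Y)=\lambda$ and $\aleph^\ast(Y)=\aleph^\ast(I_{<\mu}(X))\times\lambda^+$, where $I_{<\mu}(X)$ is the set of all injections $\alpha\to X$ with $\alpha<\mu$.
   Context: The base theory is $\mathsf{ZF}$ (no axiom of choice). ''Cardinal'' means an initial ordinal. $|X|\leq|Y|$ means there is an injection $X\to Y$; $|X|\leq^\ast|Y|$ means there is a surjection $Y\to X$ or $X=\emptyset$. The Hartogs number $\aleph(X)$ is the least ordinal $\alpha$ such that $|\alpha|\nleq|X|$; the Lindenbaum number $\aleph^\ast(X)$ is the least ordinal $\alpha$ such that $|\alpha|\nleq^\ast|X|$. Both are cardinals. For an ordinal $\alpha$, $\alpha^\alpha$ denotes the set of all functions $\alpha\to\alpha$. Products such as $\aleph^\ast(X)\times\lambda^+$ are products of cardinals, and $\lambda^+$ is the least cardinal greater than $\lambda$. *)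

(* Defs.v *)
(* A theorem of ZF is rendered as a statement about an arbitrary model (M, ∈) of
   first-order ZF; by Gödel's completeness theorem, holding in all such models is
   the same as being provable in ZF.  Separation and Replacement are schemas over
   first-order formulas with parameters, not over arbitrary predicates [M -> Prop]:
   with the latter, choice in the metatheory would force choice in M. *)

Record set_structure : Type := SetStructure {
  carrier :> Type;
  mem : carrier -> carrier -> Prop
}.

Arguments mem {s} _ _.

Notation "x ∈ y" := (mem x y) (at level 70, no associativity).

(* De Bruijn indices: under a quantifier, index 0 is the bound variable. *)
Inductive formula : Type :=
| FMem (i j : nat)
| FEq (i j : nat)
| FBot
| FAnd (p q : formula)
| FOr (p q : formula)
| FImp (p q : formula)
| FAll (p : formula)
| FEx (p : formula).

Definition env_cons {T : Type} (x : T) (e : nat -> T) (n : nat) : T :=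
  match n with
  | O => x
  | S k => e k
  end.

Fixpoint sat {M : set_structure} (e : nat -> M) (p : formula) : Prop :=
  match p with
  | FMem i j => e i ∈ e j
  | FEq i j => e i = e j
  | FBot => False
  | FAnd p q => sat e p /\ sat e q
  | FOr p q => sat e p \/ sat e q
  | FImp p q => sat e p -> sat e q
  | FAll p => forall x : M, sat (env_cons x e) p
  | FEx p => exists x : M, sat (env_cons x e) p
  end.

Definition subset {M : set_structure} (x y : M) : Prop :=
  forall z : M, z ∈ x -> z ∈ y.

Definition is_empty {M : set_structure} (x : M) : Prop :=
  forall z : M, ~ z ∈ x.

Definition nonempty {M : set_structure} (x : M) : Prop :=
  exists z : M, z ∈ x.

(* s = {x, y} *)
Definition is_upair {M : set_structure} (s x y : M) : Prop :=
  forall z : M, z ∈ s <-> z = x \/ z = y.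

(* s = x ∪ {x} *)
Definition is_succ {M : set_structure} (s x : M) : Prop :=
  forall z : M, z ∈ s <-> z ∈ x \/ z = x.

Record ZF (M : set_structure) : Prop := {
  zf_extensionality :
    forall x y : M, (forall z : M, z ∈ x <-> z ∈ y) -> x = y;
  zf_foundation :
    forall x : M, nonempty x ->
      exists y : M, y ∈ x /\ forall z : M, z ∈ y -> ~ z ∈ x;
  zf_pairing :
    forall x y : M, exists s : M, is_upair s x y;
  zf_union :
    forall x : M, exists u : M,
      forall z : M, z ∈ u <-> exists y : M, y ∈ x /\ z ∈ y;
  zf_powerset :
    forall x : M, exists p : M, forall y : M, y ∈ p <-> subset y x;
  zf_infinity :
    exists w : M,
      (exists o : M, is_empty o /\ o ∈ w) /\
      (forall x : M, x ∈ w -> exists s : M, is_succ s x /\ s ∈ w);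
  zf_separation :
    forall (p : formula) (e : nat -> M) (a : M),
      exists b : M, forall x : M, x ∈ b <-> x ∈ a /\ sat (env_cons x e) p;
  (* Index 0 is the argument x, index 1 the value y. *)
  zf_replacement :
    forall (p : formula) (e : nat -> M) (a : M),
      (forall x y y' : M, x ∈ a ->
         sat (env_cons x (env_cons y e)) p ->
         sat (env_cons x (env_cons y' e)) p -> y = y') ->
      exists b : M, forall y : M,
        y ∈ b <-> exists x : M, x ∈ a /\ sat (env_cons x (env_cons y e)) p
}.

(* p = (x, y) = {{x}, {x, y}} *)
Definition is_opair {M : set_structure} (p x y : M) : Prop :=
  forall z : M, z ∈ p <-> is_upair z x x \/ is_upair z x y.

(* (x, y) ∈ f *)
Definition maps {M : set_structure} (f x y : M) : Prop :=
  exists p : M, is_opair p x y /\ p ∈ f.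

Definition is_function {M : set_structure} (f A B : M) : Prop :=
  (forall p : M, p ∈ f ->
     exists x y : M, x ∈ A /\ y ∈ B /\ is_opair p x y) /\
  (forall x : M, x ∈ A -> exists! y : M, maps f x y).

Definition is_injection {M : set_structure} (f A B : M) : Prop :=
  is_function f A B /\
  forall x x' y : M, maps f x y -> maps f x' y -> x = x'.

Definition is_surjection {M : set_structure} (f A B : M) : Prop :=
  is_function f A B /\
  forall y : M, y ∈ B -> exists x : M, maps f x y.

Definition is_bijection {M : set_structure} (f A B : M) : Prop :=
  is_injection f A B /\ is_surjection f A B.

(* |X| = |Y|, |X| ≤ |Y| and |X| ≤* |Y| *)
Definition equinumerous {M : set_structure} (X Y : M) : Prop :=
  exists f : M, is_bijection f X Y.

Definition card_le {M : set_structure} (X Y : M) : Prop :=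
  exists f : M, is_injection f X Y.

Definition card_le_star {M : set_structure} (X Y : M) : Prop :=
  (exists f : M, is_surjection f Y X) \/ is_empty X.

Definition transitive_set {M : set_structure} (x : M) : Prop :=
  forall y : M, y ∈ x -> subset y x.

Definition well_ordered_by_mem {M : set_structure} (x : M) : Prop :=
  (forall a : M, a ∈ x -> ~ a ∈ a) /\
  (forall a b c : M, a ∈ x -> b ∈ x -> c ∈ x -> a ∈ b -> b ∈ c -> a ∈ c) /\
  (forall a b : M, a ∈ x -> b ∈ x -> a ∈ b \/ a = b \/ b ∈ a) /\
  (forall s : M, subset s x -> nonempty s ->
     exists m : M, m ∈ s /\ forall a : M, a ∈ s -> m = a \/ m ∈ a).

Definition ordinal {M : set_structure} (x : M) : Prop :=
  transitive_set x /\ well_ordered_by_mem x.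

(* The strict order on ordinals is [∈] itself. *)
Definition ord_le {M : set_structure} (x y : M) : Prop :=
  x ∈ y \/ x = y.

Definition least_ordinal {M : set_structure} (P : M -> Prop) (x : M) : Prop :=
  ordinal x /\ P x /\ forall y : M, ordinal y -> P y -> ord_le x y.

Definition cardinal {M : set_structure} (k : M) : Prop :=
  ordinal k /\ forall x : M, x ∈ k -> ~ equinumerous x k.

(* h = ℵ(X) *)
Definition is_hartogs {M : set_structure} (X h : M) : Prop :=
  least_ordinal (fun x : M => ~ card_le x X) h.

(* h = ℵ*(X) *)
Definition is_lindenbaum {M : set_structure} (X h : M) : Prop :=
  least_ordinal (fun x : M => ~ card_le_star x X) h.

(* l = k⁺ *)
Definition is_card_succ {M : set_structure} (k l : M) : Prop :=
  least_ordinal (fun x : M => cardinal x /\ k ∈ x) l.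

Definition is_cartesian {M : set_structure} (A B P : M) : Prop :=
  forall p : M,
    p ∈ P <-> exists x y : M, x ∈ A /\ y ∈ B /\ is_opair p x y.

Definition is_card_prod {M : set_structure} (k l m : M) : Prop :=
  cardinal m /\ exists P : M, is_cartesian k l P /\ equinumerous P m.

(* c = cf(x); thus cf(0) = 0 and cf(x + 1) = 1. *)
Definition is_cf {M : set_structure} (x c : M) : Prop :=
  least_ordinal
    (fun b : M => exists f : M, is_function f b x /\
       forall z : M, z ∈ x -> exists i y : M, maps f i y /\ ord_le z y)
    c.

(* w = ω *)
Definition is_omega {M : set_structure} (w : M) : Prop :=
  least_ordinal
    (fun x : M => nonempty x /\
       forall y : M, y ∈ x -> exists s : M, is_succ s y /\ s ∈ x)
    w.

Definition singular {M : set_structure} (k : M) : Prop :=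
  cardinal k /\
  (exists w : M, is_omega w /\ ord_le w k) /\
  (exists c : M, is_cf k c /\ c ∈ k).

(* Here ω counts as a limit cardinal; 0 and the positive finite cardinals do not. *)
Definition limit_cardinal {M : set_structure} (k : M) : Prop :=
  cardinal k /\ nonempty k /\
  forall x : M, x ∈ k -> cardinal x ->
    exists y : M, is_card_succ x y /\ y ∈ k.

(* s = sup {x | P x}, for a property P of ordinals *)
Definition is_ord_sup {M : set_structure} (P : M -> Prop) (s : M) : Prop :=
  least_ordinal (fun b : M => forall x : M, P x -> ord_le x b) s.

(* F is the set of all functions A -> B *)
Definition is_function_set {M : set_structure} (A B F : M) : Prop :=
  forall f : M, f ∈ F <-> is_function f A B.

(* x = ℵ(a^a) for some a < m *)
Definition hartogs_of_power_below {M : set_structure} (m x : M) : Prop :=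
  exists a F : M, a ∈ m /\ is_function_set a a F /\ is_hartogs F x.

(* I = I_{<m}(X), the set of all injections a -> X with a < m *)
Definition is_injections_below {M : set_structure} (m X I : M) : Prop :=
  forall f : M, f ∈ I <-> exists a : M, a ∈ m /\ is_injection f a X.

(* Main.v *)
From Stdlib Require Import Classical ClassicalEpsilon PeanoNat.
Require Import Defs.

(** Both parts come from one construction.  Let [Z] be a set and [F : Z -> lam] a map
    with unbounded values into an infinite cardinal, and let [Y] be the set of pairs
    [(x, b)] with [b <= F x < lam].  Every ordinal below [lam] injects into [Y], inside
    a single column, and [Y] maps onto [Z] and onto [lam] by its two projections.  An
    injection of [lam] into [Y] projects to a well-orderable subset [A] of [Z].  If
    every such [A] has size below [lam] and [F] is bounded by some [d < lam] on it, then
    [lam] would inject into [A * (d + 1)], a product of two sets of size below [lam];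
    by Hessenberg's theorem [card_le_square] this is impossible, so the Hartogs number
    of [Y] is [lam].  This is [pairs_below].

    The Lindenbaum number of [Y] is at least the maximum of that of [Z] and [lam+], by
    the two projections.  That it is not larger is [card_le_star_prod]: an infinite
    cardinal [th > lam] onto which [X * lam] maps is already an image of [X].  When
    [th] is regular this is a count, but successor cardinals and Lindenbaum numbers may
    be singular here.  A surjection is a family of functions [val b] from [X] to
    [th], for [b < lam].  Assume that [X] does not map onto [th].  Call a
    subset of [X] negligible if the family takes fewer than [th] values on it.  The key
    remark, [no_selection], is that if [X] is cut into disjoint pieces, indexed by
    ordinals, and for each piece [j] one coordinate [b j] can be chosen definably such
    that the order types of the sets of values of [val (b j)] on the [j]th piece are
    cofinal in [th], then collapsing these sets gives a surjection from [X] onto [th].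
    Hence unions of fewer than [th] negligible pieces are negligible
    ([negligible_of_pieces]), and the number of non-negligible fibers of [val b] is
    bounded below [th] independently of [b] ([big_values_bounded]).  The points that
    lie in some negligible fiber form a negligible set; on the remaining ones all
    values are among fewer than [th] many.  So [X] is negligible, a contradiction.

    For (a), [Z] is [X], and [F] composes a surjection of [X] onto [cf lam] with a
    cofinal map; a well-orderable subset of [X] has fewer than [cf lam] elements, so
    [F] is bounded on it.  For (b), [Z] is the set of injections of ordinals below [mu]
    into [X], and [F] depends only on the domain, through a monotone map from [mu] to
    [lam].  The ranges in a well-ordered family of such injections have a
    well-orderable union, of size [w < mu]; the domains are then bounded in [mu]
    ([family_dom_bounded]), and coding the injections as functions from an ordinal
    below [mu] to itself shows that the family has size below [lam] ([family_small]).

    All of this takes place in a model [M] of ZF, where Separation and Replacement are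
    available for first-order formulas with parameters only.  A predicate on [M] is
    called [Definable] if such a formula expresses it.  Every set and every map on [M]
    below is built from definable descriptions, so that definability is found by proof
    search, and well-ordered choices are made by [least]. *)

Existing Class ZF.

(** * Definability over a structure *)

Fixpoint rename (r : nat -> nat) (p : formula) : formula :=
  let up := fun n => match n with O => O | S k => S (r k) end in
  match p with
  | FMem i j => FMem (r i) (r j)
  | FEq i j => FEq (r i) (r j)
  | FBot => FBot
  | FAnd p q => FAnd (rename r p) (rename r q)
  | FOr p q => FOr (rename r p) (rename r q)
  | FImp p q => FImp (rename r p) (rename r q)
  | FAll p => FAll (rename up p)
  | FEx p => FEx (rename up p)
  end.

Lemma sat_rename {M : set_structure} (p : formula) :
  forall (r : nat -> nat) (e e' : nat -> M),
    (forall n, e (r n) = e' n) -> (sat e (rename r p) <-> sat e' p).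
Proof.
  induction p; intros r e e' H; simpl; rewrite ?H; try tauto;
    try (rewrite (IHp1 r e e' H), (IHp2 r e e' H); tauto).
  - split; intros K x; specialize (K x); revert K; apply IHp;
      intros [|n]; simpl; auto.
  - split; intros [x K]; exists x; revert K; apply IHp;
      intros [|n]; simpl; auto.
Qed.

Definition interleave {T : Type} (e1 e2 : nat -> T) (n : nat) : T :=
  if Nat.even n then e1 (Nat.div2 n) else e2 (Nat.div2 n).

Lemma interleave_left {T : Type} (e1 e2 : nat -> T) n :
  interleave e1 e2 (2 * n) = e1 n.
Proof. unfold interleave. now rewrite Nat.even_even, Nat.div2_double. Qed.

Lemma interleave_right {T : Type} (e1 e2 : nat -> T) n :
  interleave e1 e2 (S (2 * n)) = e2 n.
Proof.
  unfold interleave. rewrite Nat.div2_succ_double, Nat.even_succ.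
  now rewrite Nat.odd_even.
Qed.

(** A context is an iterated product of copies of [M] over [unit]: its components
    are the free variables, the last one having De Bruijn index 0.  The parameters
    of a definition follow them; [ctx_shift] gives their indices, and
    [ctx_left] and [ctx_right] let two definitions share one list of parameters. *)
Class Ctx (M : set_structure) (C : Type) := {
  ctx_env : C -> (nat -> M) -> nat -> M;
  ctx_left : nat -> nat;
  ctx_right : nat -> nat;
  ctx_shift : nat -> nat;
  ctx_left_spec : forall c e1 e2 n,
    ctx_env c (interleave e1 e2) (ctx_left n) = ctx_env c e1 n;
  ctx_right_spec : forall c e1 e2 n,
    ctx_env c (interleave e1 e2) (ctx_right n) = ctx_env c e2 n;
  ctx_shift_spec : forall c e n, ctx_env c e (ctx_shift n) = e n
}.

#[global] Program Instance ctx_unit (M : set_structure) : Ctx M unit := {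
  ctx_env := fun _ e => e;
  ctx_left := fun n => 2 * n;
  ctx_right := fun n => S (2 * n);
  ctx_shift := fun n => n
}.
Next Obligation. intros. apply interleave_left. Qed.
Next Obligation. intros. apply interleave_right. Qed.

#[global] Program Instance ctx_prod (M : set_structure) (C : Type) `{Ctx M C} :
  Ctx M (C * M)%type := {
  ctx_env := fun c e => env_cons (snd c) (ctx_env (fst c) e);
  ctx_left := fun n => match n with O => O | S k => S (ctx_left k) end;
  ctx_right := fun n => match n with O => O | S k => S (ctx_right k) end;
  ctx_shift := fun n => S (ctx_shift n)
}.
Next Obligation. intros. destruct n; simpl; auto using ctx_left_spec. Qed.
Next Obligation. intros. destruct n; simpl; auto using ctx_right_spec. Qed.
Next Obligation. intros. simpl. apply ctx_shift_spec. Qed.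

Class Definable {M : set_structure} {C : Type} {HC : Ctx M C} (P : C -> Prop) : Prop :=
  definable_by : exists (p : formula) (e : nat -> M),
    forall c, P c <-> sat (ctx_env c e) p.

(** The language has no function symbols: a term is definable through its graph. *)
Class DefTerm {M : set_structure} {C : Type} {HC : Ctx M C} (t : C -> M) : Prop :=
  def_term_graph : Definable (fun cy : C * M => snd cy = t (fst cy)).

Section Definability.
Context {M : set_structure} {HM : ZF M}.

Lemma zf_inhabited : inhabited M.
Proof. destruct (zf_infinity M HM) as [w _]. exact (inhabits w). Qed.

Lemma definable_ext {C : Type} {HC : Ctx M C} (P Q : C -> Prop) :
  (forall c, P c <-> Q c) -> Definable P -> Definable Q.
Proof.
  intros E (p & e & H). exists p, e. intro c. rewrite <- E. apply H.
Qed.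

Lemma definable_binop {C : Type} {HC : Ctx M C} (P Q : C -> Prop)
    (F : formula -> formula -> formula) (G : Prop -> Prop -> Prop) :
  (forall (e : nat -> M) p q, sat e (F p q) <-> G (sat e p) (sat e q)) ->
  (forall A A' B B' : Prop, (A <-> A') -> (B <-> B') -> (G A B <-> G A' B')) ->
  Definable P -> Definable Q -> Definable (fun c => G (P c) (Q c)).
Proof.
  intros HF HG (p & e1 & Hp) (q & e2 & Hq).
  exists (F (rename ctx_left p) (rename ctx_right q)), (interleave e1 e2).
  intro c. rewrite HF. apply HG.
  - rewrite Hp. symmetry. apply sat_rename. intro n. apply ctx_left_spec.
  - rewrite Hq. symmetry. apply sat_rename. intro n. apply ctx_right_spec.
Qed.

#[global] Instance definable_and {C} {HC : Ctx M C} (P Q : C -> Prop) :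
  Definable P -> Definable Q -> Definable (fun c => P c /\ Q c).
Proof. apply (definable_binop P Q FAnd and); simpl; tauto. Qed.

#[global] Instance definable_or {C} {HC : Ctx M C} (P Q : C -> Prop) :
  Definable P -> Definable Q -> Definable (fun c => P c \/ Q c).
Proof. apply (definable_binop P Q FOr or); simpl; tauto. Qed.

#[global] Instance definable_imp {C} {HC : Ctx M C} (P Q : C -> Prop) :
  Definable P -> Definable Q -> Definable (fun c => P c -> Q c).
Proof. apply (definable_binop P Q FImp (fun A B => A -> B)); simpl; tauto. Qed.

#[global] Instance definable_iff {C} {HC : Ctx M C} (P Q : C -> Prop) :
  Definable P -> Definable Q -> Definable (fun c => P c <-> Q c).
Proof. intros HP HQ. exact (definable_and _ _ (definable_imp _ _ HP HQ) (definable_imp _ _ HQ HP)). Qed.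

(** A proposition that does not depend on the context is equivalent to a closed formula,
    being true or false. *)
Lemma definable_const {C} {HC : Ctx M C} (P : Prop) :
  Definable (fun _ : C => P).
Proof.
  destruct zf_inhabited as [a].
  destruct (classic P) as [HP|HP].
  - exists (FImp FBot FBot), (fun _ => a). simpl. tauto.
  - exists FBot, (fun _ => a). simpl. tauto.
Qed.

#[global] Instance definable_not {C} {HC : Ctx M C} (P : C -> Prop) :
  Definable P -> Definable (fun c => ~ P c).
Proof.
  intros (p & e & H). exists (FImp p FBot), e. intro c. simpl. rewrite (H c). tauto.
Qed.

#[global] Instance definable_all {C} {HC : Ctx M C} (P : C -> M -> Prop) :
  Definable (fun cx : C * M => P (fst cx) (snd cx)) ->
  Definable (fun c => forall x, P c x).
Proof.
  intros (p & e & H). exists (FAll p), e. intro c. simpl.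
  split; intros K x; apply (H (c, x)); apply K.
Qed.

#[global] Instance definable_ex {C} {HC : Ctx M C} (P : C -> M -> Prop) :
  Definable (fun cx : C * M => P (fst cx) (snd cx)) ->
  Definable (fun c => exists x, P c x).
Proof.
  intros (p & e & H). exists (FEx p), e. intro c. simpl.
  split; intros [x K]; exists x; apply (H (c, x)); apply K.
Qed.

Lemma definable_rename {C C'} {HC : Ctx M C} {HC' : Ctx M C'}
    (r : nat -> nat) (h : C' -> C) (P : C -> Prop) :
  (forall c e n, ctx_env c e (r n) = ctx_env (h c) e n) ->
  Definable P -> Definable (fun c => P (h c)).
Proof.
  intros Hr (p & e & H). exists (rename r p), e. intro c. rewrite H.
  symmetry. apply sat_rename. intro n. apply Hr.
Qed.

Lemma definable_weaken {C} {HC : Ctx M C} (P : C -> Prop) :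
  Definable P -> Definable (fun c : C * M => P (fst c)).
Proof. apply (definable_rename S). reflexivity. Qed.

Lemma definable_weaken_under {C} {HC : Ctx M C} (P : C -> M -> Prop) :
  Definable (fun c : C * M => P (fst c) (snd c)) ->
  Definable (fun c : C * M * M => P (fst (fst c)) (snd c)).
Proof.
  apply (definable_rename (fun n => match n with O => O | S k => S (S k) end)
           (fun c : C * M * M => (fst (fst c), snd c)) (fun c => P (fst c) (snd c))).
  now intros c e [|n].
Qed.


Lemma def_term_var {C} {HC : Ctx M C} : DefTerm (fun c : C * M => snd c).
Proof. destruct zf_inhabited as [a]. exists (FEq 0 1), (fun _ => a). simpl. tauto. Qed.

Lemma def_term_weaken {C} {HC : Ctx M C} (t : C -> M) :
  DefTerm t -> DefTerm (fun c : C * M => t (fst c)).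
Proof. exact (definable_weaken_under (fun c y => y = t c)). Qed.

Lemma def_term_const {C} {HC : Ctx M C} (a : M) : DefTerm (fun _ : C => a).
Proof.
  exists (FEq 0 (S (ctx_shift 0))), (fun _ => a). intro c. simpl.
  now rewrite ctx_shift_spec.
Qed.

Lemma definable_subst {C} {HC : Ctx M C} (P : C -> M -> Prop) (t : C -> M) :
  DefTerm t -> Definable (fun c : C * M => P (fst c) (snd c)) ->
  Definable (fun c => P c (t c)).
Proof.
  intros Ht HP.
  apply (definable_ext (fun c => exists y, y = t c /\ P c y)).
  - intro c. split; [intros (y & -> & K); exact K | eauto].
  - apply definable_ex. apply definable_and; assumption.
Qed.

#[global] Instance definable_eq {C} {HC : Ctx M C} (t u : C -> M) :
  DefTerm t -> DefTerm u -> Definable (fun c => t c = u c).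
Proof. intros Ht Hu. exact (definable_subst (fun c y => y = u c) t Ht Hu). Qed.

#[global] Instance definable_mem {C} {HC : Ctx M C} (t u : C -> M) :
  DefTerm t -> DefTerm u -> Definable (fun c => t c ∈ u c).
Proof.
  intros Ht Hu. destruct zf_inhabited as [a].
  apply (definable_subst (fun c y => y ∈ u c) t Ht).
  apply (definable_subst (fun (c : C * M) z => snd c ∈ z) (fun c => u (fst c))).
  - now apply def_term_weaken.
  - exists (FMem 1 0), (fun _ => a). simpl. tauto.
Qed.

Lemma definable_closed1 {C} {HC : Ctx M C} (P : M -> Prop) (t : C -> M) :
  Definable (fun c : unit * M => P (snd c)) -> DefTerm t ->
  Definable (fun c => P (t c)).
Proof.
  intros HP Ht. apply (definable_subst (fun _ x => P x) t Ht).
  refine (definable_rename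
    (fun n => match n with O => O | S k => S (ctx_shift k) end)
    (fun c : C * M => (tt, snd c)) (fun c => P (snd c)) _ HP).
  intros c e [|n]; simpl; auto using ctx_shift_spec.
Qed.

Lemma def_term_closed1 {C} {HC : Ctx M C} (F : M -> M) (t : C -> M) :
  DefTerm (fun c : unit * M => F (snd c)) -> DefTerm t ->
  DefTerm (fun c => F (t c)).
Proof.
  intros HF Ht.
  apply (definable_subst (fun (c : C * M) x => snd c = F x) (fun c => t (fst c))).
  - now apply def_term_weaken.
  - refine (definable_rename
      (fun n => match n with 0 => 1 | 1 => 0 | S (S k) => S (S (ctx_shift k)) end)
      (fun c : C * M * M => (tt, snd c, snd (fst c)))
      (fun c : unit * M * M => snd c = F (snd (fst c))) _ HF).
    intros c e [|[|n]]; simpl; auto using ctx_shift_spec.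
Qed.

(** Definite description, with the value [∅] when no unique witness exists, so
    that every definable description yields a total class function. *)
Definition iota (P : M -> Prop) : M :=
  epsilon zf_inhabited (fun y =>
    (P y /\ forall z, P z -> z = y) \/
    (~ (exists x, P x /\ forall z, P z -> z = x) /\ is_empty y)).

Lemma iota_spec (P : M -> Prop) :
  (exists x, P x /\ forall z, P z -> z = x) ->
  P (iota P) /\ forall z, P z -> z = iota P.
Proof.
  intro E. unfold iota.
  match goal with |- P (epsilon ?i ?Q) /\ _ => destruct (epsilon_spec i Q) as [K|[K _]] end.
  - destruct E as (x & E). exists x. now left.
  - exact K.
  - contradiction.
Qed.

Lemma is_empty_unique (x y : M) : is_empty x -> is_empty y -> x = y.
Proof.
  intros Hx Hy. apply (zf_extensionality M HM). intro z.
  split; intro K; [destruct (Hx z K) | destruct (Hy z K)].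
Qed.

Lemma ex_empty : exists x : M, is_empty x.
Proof.
  destruct (zf_infinity M HM) as (w & (o & Ho & _) & _). now exists o.
Qed.

Lemma iota_eq (P : M -> Prop) (y : M) :
  y = iota P <->
  (P y /\ forall z, P z -> z = y) \/
  (~ (exists x, P x /\ forall z, P z -> z = x) /\ is_empty y).
Proof.
  assert (K : (P (iota P) /\ forall z, P z -> z = iota P) \/
    (~ (exists x, P x /\ forall z, P z -> z = x) /\ is_empty (iota P))).
  { unfold iota.
    match goal with |- context [epsilon ?i ?Q] => apply (epsilon_spec i Q) end.
    destruct (classic (exists x, P x /\ forall z, P z -> z = x)) as [(x & H)|H].
    - exists x. now left.
    - destruct ex_empty as [x Hx]. exists x. now right. }
  split; [now intros -> | intros [[H1 H2]|[H1 H2]]].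
  - destruct K as [[K1 K2]|[K _]]; [now apply K2 | destruct K; eauto].
  - destruct K as [K|[_ K]]; [destruct H1; eauto | now apply is_empty_unique].
Qed.

#[global] Instance definable_empty {C} {HC : Ctx M C} (t : C -> M) :
  DefTerm t -> Definable (fun c => is_empty (t c)).
Proof.
  intro Ht. unfold is_empty. apply definable_all, definable_not, definable_mem.
  - apply def_term_var.
  - now apply def_term_weaken.
Qed.

#[global] Instance def_iota {C} {HC : Ctx M C} (P : C -> M -> Prop) :
  Definable (fun c : C * M => P (fst c) (snd c)) ->
  DefTerm (fun c => iota (P c)).
Proof.
  intro HP.
  apply (definable_ext (fun cy : C * M =>
    (P (fst cy) (snd cy) /\ forall z, P (fst cy) z -> z = snd cy) \/
    (~ (exists x, P (fst cy) x /\ forall z, P (fst cy) z -> z = x) /\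
      is_empty (snd cy)))).
  { intros [c y]. symmetry. apply iota_eq. }
  apply definable_or, definable_and, definable_empty, def_term_var.
  - apply definable_and; [exact HP|]. apply definable_all, definable_imp.
    + now apply definable_weaken_under.
    + apply definable_eq; [apply def_term_var | apply def_term_weaken, def_term_var].
  - apply definable_not, definable_ex, definable_and.
    + now apply definable_weaken_under.
    + apply definable_all, definable_imp.
      * apply definable_weaken_under in HP.
        now apply (definable_weaken_under (fun c => P (fst c))).
      * apply definable_eq; [apply def_term_var | apply def_term_weaken, def_term_var].
Qed.

End Definability.

(** Unification does not find [t] in [fun c => t (fst c)], so the depth at which a
    variable or a term of the context sits is found by trial. *)
Ltac def_weaken H :=
  first
    [ exact H
    | exact (def_term_weaken _ H)
    | exact (def_term_weaken _ (def_term_weaken _ H))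
    | exact (def_term_weaken _ (def_term_weaken _ (def_term_weaken _ H)))
    | exact (def_term_weaken _ (def_term_weaken _ (def_term_weaken _
        (def_term_weaken _ H))))
    | exact (def_term_weaken _ (def_term_weaken _ (def_term_weaken _
        (def_term_weaken _ (def_term_weaken _ H)))))
    | exact (def_term_weaken _ (def_term_weaken _ (def_term_weaken _
        (def_term_weaken _ (def_term_weaken _ (def_term_weaken _ H)))))) ].

#[global] Hint Extern 0 (Definable (fun _ => ?P)) => exact (definable_const P) : typeclass_instances.
#[global] Hint Extern 0 (DefTerm (fun _ => ?a)) => exact (def_term_const a) : typeclass_instances.
#[global] Hint Extern 0 (DefTerm (fun c => snd _)) => def_weaken uconstr:(def_term_var) : typeclass_instances.
#[global] Hint Extern 0 (DefTerm snd) => exact def_term_var : typeclass_instances.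
#[global] Hint Extern 0 (DefTerm (fun c => ?t _)) =>
  match goal with H : DefTerm t |- _ => def_weaken H end : typeclass_instances.
#[global] Hint Extern 1 (Definable (fun c => unique _ _)) => unfold unique : typeclass_instances.
#[global] Hint Extern 1 (DefTerm (fun c => ?F (@?t c))) =>
  match goal with H : DefTerm (fun c : unit * _ => F (snd c)) |- _ =>
    refine (def_term_closed1 F t H _) end : typeclass_instances.
#[global] Hint Extern 1 (Definable (fun c => ?F (@?t c))) =>
  match goal with H : Definable (fun c : unit * _ => F (snd c)) |- _ =>
    refine (definable_closed1 F t H _) end : typeclass_instances.

Ltac dfn := cbv beta; solve [typeclasses eauto].

(** * Set constructions *)

Section Sets.
Context {M : set_structure} {HM : ZF M}.


#[global] Instance definable_nonempty {C} {HC : Ctx M C} (t : C -> M) :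
  DefTerm t -> Definable (fun c => nonempty (t c)).
Proof. intros. unfold nonempty. dfn. Qed.

#[global] Instance definable_function {C} {HC : Ctx M C} (s t u : C -> M) :
  DefTerm s -> DefTerm t -> DefTerm u ->
  Definable (fun c => is_function (s c) (t c) (u c)).
Proof. intros. unfold is_function. dfn. Qed.

#[global] Instance definable_injection {C} {HC : Ctx M C} (s t u : C -> M) :
  DefTerm s -> DefTerm t -> DefTerm u ->
  Definable (fun c => is_injection (s c) (t c) (u c)).
Proof. intros. unfold is_injection. dfn. Qed.

#[global] Instance definable_card_le {C} {HC : Ctx M C} (t u : C -> M) :
  DefTerm t -> DefTerm u -> Definable (fun c => card_le (t c) (u c)).
Proof. intros. unfold card_le. dfn. Qed.

#[global] Instance definable_card_le_star {C} {HC : Ctx M C} (t u : C -> M) :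
  DefTerm t -> DefTerm u -> Definable (fun c => card_le_star (t c) (u c)).
Proof. intros. unfold card_le_star. dfn. Qed.

#[global] Instance definable_ordinal {C} {HC : Ctx M C} (t : C -> M) :
  DefTerm t -> Definable (fun c => ordinal (t c)).
Proof. intros. unfold ordinal, transitive_set, well_ordered_by_mem. dfn. Qed.

#[global] Instance definable_ord_le {C} {HC : Ctx M C} (t u : C -> M) :
  DefTerm t -> DefTerm u -> Definable (fun c => ord_le (t c) (u c)).
Proof. intros. unfold ord_le. dfn. Qed.

#[global] Instance definable_cardinal {C} {HC : Ctx M C} (t : C -> M) :
  DefTerm t -> Definable (fun c => cardinal (t c)).
Proof. intros. unfold cardinal. dfn. Qed.

Definition sep (A : M) (P : M -> Prop) : M :=
  iota (fun b => forall x, x ∈ b <-> x ∈ A /\ P x).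

#[global] Instance def_sep {C} {HC : Ctx M C} (A : C -> M) (P : C -> M -> Prop) :
  DefTerm A -> Definable (fun c : C * M => P (fst c) (snd c)) ->
  DefTerm (fun c => sep (A c) (P c)).
Proof.
  intros HA HP. apply definable_weaken_under in HP. unfold sep. dfn.
Qed.

Lemma in_sep (A : M) (P : M -> Prop) (x : M) :
  Definable (fun c : unit * M => P (snd c)) ->
  (x ∈ sep A P <-> x ∈ A /\ P x).
Proof.
  intros (p & e & H). refine (proj1 (iota_spec (fun b => forall x, x ∈ b <-> x ∈ A /\ P x) _) x).
  destruct (zf_separation M HM p e A) as [b Hb].
  assert (K : forall x, x ∈ b <-> x ∈ A /\ P x).
  { intro z. rewrite Hb. rewrite (H (tt, z)). reflexivity. }
  exists b. split; [exact K|]. intros b' K'.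
  apply (zf_extensionality M HM). intro z. now rewrite K, K'.
Qed.

Definition image (A : M) (F : M -> M) : M :=
  iota (fun b => forall y, y ∈ b <-> exists x, x ∈ A /\ y = F x).

#[global] Instance def_image {C} {HC : Ctx M C} (A : C -> M) (F : C -> M -> M) :
  DefTerm A -> DefTerm (fun c : C * M => F (fst c) (snd c)) ->
  DefTerm (fun c => image (A c) (F c)).
Proof.
  intros HA HF. unfold image. apply def_iota, definable_all, definable_iff; [dfn|].
  apply definable_ex, definable_and; [dfn|].
  refine (definable_rename
    (fun n => match n with 0 => 1 | 1 => 0 | S (S k) => S (S (S k)) end)
    (fun c : C * M * M * M => (fst (fst (fst c)), snd c, snd (fst c))) 
    (fun c : C * M * M => snd c = F (fst (fst c)) (snd (fst c))) _ HF).
  now intros c e [|[|n]].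
Qed.

Lemma in_image (A : M) (F : M -> M) (y : M) :
  DefTerm (fun c : unit * M => F (snd c)) ->
  (y ∈ image A F <-> exists x, x ∈ A /\ y = F x).
Proof.
  intro HF.
  refine (proj1 (iota_spec
    (fun b => forall y, y ∈ b <-> exists x, x ∈ A /\ y = F x) _) y).
  assert (D : Definable (fun c : unit * M * M => snd (fst c) = F (snd c))) by dfn.
  destruct D as (p & e & H).
  destruct (zf_replacement M HM p e A) as [b Hb].
  { intros x z z' _ K K'. apply (H (tt, z, x)) in K. apply (H (tt, z', x)) in K'.
    simpl in *. congruence. }
  assert (K : forall y, y ∈ b <-> exists x, x ∈ A /\ y = F x).
  { intro y'. rewrite Hb. split; intros (x & Hx & Hy); exists x; split; trivial;
      apply (H (tt, y', x)); exact Hy. }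
  exists b. split; [exact K|]. intros b' K'.
  apply (zf_extensionality M HM). intro z. now rewrite K, K'.
Qed.

End Sets.
(* Proof search for definability must not unfold these constants. *)
#[global] Typeclasses Opaque iota sep image nonempty is_empty is_function is_injection
  card_le card_le_star ordinal ord_le cardinal.

(** * Pairs, products and functions *)

Section Functions.
Context {M : set_structure} {HM : ZF M}.

Lemma set_ext (x y : M) : (forall z, z ∈ x <-> z ∈ y) -> x = y.
Proof. apply (zf_extensionality M HM). Qed.

Lemma in_iota_set (Q : M -> Prop) (z : M) :
  (exists b, forall z, z ∈ b <-> Q z) ->
  (z ∈ iota (fun b => forall z, z ∈ b <-> Q z) <-> Q z).
Proof.
  intros [b Hb]. revert z.
  apply (iota_spec (fun b => forall z, z ∈ b <-> Q z)).
  exists b. split; [exact Hb|]. intros b' Hb'.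
  apply set_ext. intro z. now rewrite Hb, Hb'.
Qed.

Definition emptyset : M := iota is_empty.

Lemma not_in_empty (x : M) : ~ x ∈ emptyset.
Proof.
  revert x. apply (iota_spec is_empty). destruct ex_empty as [o Ho].
  exists o. split; [exact Ho|]. intros o' Ho'. now apply is_empty_unique.
Qed.

Definition upair (x y : M) : M := iota (fun s => forall z, z ∈ s <-> z = x \/ z = y).

Lemma in_upair (x y z : M) : z ∈ upair x y <-> z = x \/ z = y.
Proof. apply in_iota_set, (zf_pairing M HM). Qed.

Definition union (A : M) : M :=
  iota (fun b => forall z, z ∈ b <-> exists y, y ∈ A /\ z ∈ y).

#[global] Instance def_union {C} {HC : Ctx M C} (t : C -> M) :
  DefTerm t -> DefTerm (fun c => union (t c)).
Proof. intros. unfold union. dfn. Qed.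

Lemma in_union (A z : M) : z ∈ union A <-> exists y, y ∈ A /\ z ∈ y.
Proof. apply in_iota_set, (zf_union M HM). Qed.

Definition pow (A : M) : M := iota (fun b => forall z, z ∈ b <-> subset z A).

Lemma in_pow (A z : M) : z ∈ pow A <-> subset z A.
Proof. apply (in_iota_set (fun z => subset z A)), (zf_powerset M HM). Qed.

Definition cup (a b : M) : M := union (upair a b).

#[global] Instance def_cup {C} {HC : Ctx M C} (t u : C -> M) :
  DefTerm t -> DefTerm u -> DefTerm (fun c => cup (t c) (u c)).
Proof. intros. unfold cup. dfn. Qed.

Lemma in_cup (a b z : M) : z ∈ cup a b <-> z ∈ a \/ z ∈ b.
Proof.
  unfold cup. rewrite in_union. split.
  - intros (y & Hy & Hz). apply in_upair in Hy. destruct Hy as [-> | ->]; tauto.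
  - intros [H|H]; [exists a | exists b]; rewrite in_upair; tauto.
Qed.

Definition succ (a : M) : M := cup a (upair a a).

#[global] Instance def_succ {C} {HC : Ctx M C} (t : C -> M) :
  DefTerm t -> DefTerm (fun c => succ (t c)).
Proof. intros. unfold succ. dfn. Qed.

Lemma in_succ (a z : M) : z ∈ succ a <-> z ∈ a \/ z = a.
Proof. unfold succ. rewrite in_cup, in_upair. tauto. Qed.

Definition opair (x y : M) : M := upair (upair x x) (upair x y).

#[global] Instance def_opair {C} {HC : Ctx M C} (t u : C -> M) :
  DefTerm t -> DefTerm u -> DefTerm (fun c => opair (t c) (u c)).
Proof. intros. unfold opair. dfn. Qed.

Lemma is_upair_iff (s x y : M) : is_upair s x y <-> s = upair x y.
Proof.
  split.
  - intro H. apply set_ext. intro z. now rewrite in_upair.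
  - intros -> z. apply in_upair.
Qed.

Lemma is_opair_iff (p x y : M) : is_opair p x y <-> p = opair x y.
Proof.
  unfold is_opair. split.
  - intro H. apply set_ext. intro z. unfold opair.
    now rewrite H, in_upair, !is_upair_iff.
  - intros -> z. unfold opair. now rewrite in_upair, !is_upair_iff.
Qed.

Lemma maps_iff (f x y : M) : maps f x y <-> opair x y ∈ f.
Proof.
  unfold maps. split.
  - intros (p & Hp & Hf). apply is_opair_iff in Hp. now subst.
  - intro H. exists (opair x y). now rewrite is_opair_iff.
Qed.

Lemma upair_inj_r (x y z : M) : upair x y = upair x z -> y = z.
Proof.
  intro E.
  assert (Hy : y ∈ upair x z) by (rewrite <- E; apply in_upair; tauto).
  assert (Hz : z ∈ upair x y) by (rewrite E; apply in_upair; tauto).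
  apply in_upair in Hy, Hz. intuition congruence.
Qed.

Lemma opair_inj (x y x' y' : M) : opair x y = opair x' y' -> x = x' /\ y = y'.
Proof.
  intro E.
  assert (Ex : x = x').
  { assert (H : upair x x ∈ opair x' y') by (rewrite <- E; apply in_upair; tauto).
    assert (Hx : x' ∈ upair x x).
    { apply in_upair in H. destruct H as [-> | ->]; apply in_upair; tauto. }
    apply in_upair in Hx. intuition congruence. }
  subst x'. split; trivial. apply upair_inj_r in E. now apply upair_inj_r in E.
Qed.

Definition pr1 (p : M) : M := iota (fun x => exists y, p = opair x y).
Definition pr2 (p : M) : M := iota (fun y => exists x, p = opair x y).

#[global] Instance def_pr1 {C} {HC : Ctx M C} (t : C -> M) :
  DefTerm t -> DefTerm (fun c => pr1 (t c)).
Proof. intros. unfold pr1. dfn. Qed.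

#[global] Instance def_pr2 {C} {HC : Ctx M C} (t : C -> M) :
  DefTerm t -> DefTerm (fun c => pr2 (t c)).
Proof. intros. unfold pr2. dfn. Qed.

Lemma iota_unique (P : M -> Prop) (x : M) :
  P x -> (forall z, P z -> z = x) -> iota P = x.
Proof.
  intros H U. symmetry. apply (iota_spec P); eauto.
Qed.

Lemma pr1_opair (x y : M) : pr1 (opair x y) = x.
Proof.
  apply iota_unique; [eauto|]. intros z [w E]. apply opair_inj in E. now symmetry.
Qed.

Lemma pr2_opair (x y : M) : pr2 (opair x y) = y.
Proof.
  apply iota_unique; [eauto|]. intros z [w E]. apply opair_inj in E. now symmetry.
Qed.

Definition prod (A B : M) : M := union (image A (fun a => image B (fun b => opair a b))).

#[global] Instance def_prod {C} {HC : Ctx M C} (t u : C -> M) :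
  DefTerm t -> DefTerm u -> DefTerm (fun c => prod (t c) (u c)).
Proof. intros. unfold prod. dfn. Qed.

Lemma in_prod (A B p : M) :
  p ∈ prod A B <-> exists a b, a ∈ A /\ b ∈ B /\ p = opair a b.
Proof.
  unfold prod. rewrite in_union. split.
  - intros (y & Hy & Hp). rewrite in_image in Hy by dfn. destruct Hy as (a & Ha & ->).
    rewrite in_image in Hp by dfn. destruct Hp as (b & Hb & ->). eauto.
  - intros (a & b & Ha & Hb & ->). exists (image B (fun b => opair a b)).
    split; rewrite in_image by dfn; [now exists a | now exists b].
Qed.

Lemma in_prod_opair (A B x y : M) : opair x y ∈ prod A B <-> x ∈ A /\ y ∈ B.
Proof.
  rewrite in_prod. split.
  - intros (a & b & Ha & Hb & E). apply opair_inj in E as [-> ->]. tauto.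
  - intros []. eauto.
Qed.

Lemma is_cartesian_iff (A B P : M) : is_cartesian A B P <-> P = prod A B.
Proof.
  unfold is_cartesian. split.
  - intro H. apply set_ext. intro p. rewrite H, in_prod.
    split; intros (x & y & Hx & Hy & E); apply is_opair_iff in E; eauto.
  - intros -> p. rewrite in_prod.
    split; intros (x & y & Hx & Hy & E); apply is_opair_iff in E; eauto 6.
Qed.

Definition app (f x : M) : M := iota (fun y => opair x y ∈ f).

#[global] Instance def_app {C} {HC : Ctx M C} (t u : C -> M) :
  DefTerm t -> DefTerm u -> DefTerm (fun c => app (t c) (u c)).
Proof. intros. unfold app. dfn. Qed.

Lemma function_maps (f A B x y : M) :
  is_function f A B -> (maps f x y <-> x ∈ A /\ y = app f x).
Proof.
  intros [Hf Hu].
  assert (K : forall x, x ∈ A -> maps f x (app f x) /\ forall y, maps f x y -> y = app f x).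
  { intros z Hz. destruct (Hu z Hz) as (w & Hw & Hw').
    assert (E : app f z = w).
    { apply iota_unique; [now apply maps_iff|]. intros v Hv. symmetry.
      now apply Hw', maps_iff. }
    rewrite E. split; [exact Hw|]. intros v Hv. symmetry. auto. }
  split.
  - intro H. assert (Hx : x ∈ A).
    { apply maps_iff in H. destruct (Hf _ H) as (a & b & Ha & _ & E).
      apply is_opair_iff, opair_inj in E. destruct E. now subst. }
    split; trivial. now apply K.
  - intros [Hx ->]. now apply K.
Qed.

Lemma function_app (f A B x : M) : is_function f A B -> x ∈ A -> app f x ∈ B.
Proof.
  intros Hf Hx. destruct (function_maps f A B x (app f x) Hf) as [_ K].
  specialize (K (conj Hx eq_refl)). apply maps_iff in K.
  destruct (proj1 Hf _ K) as (a & b & _ & Hb & E).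
  apply is_opair_iff, opair_inj in E. destruct E. now subst.
Qed.

Lemma function_elements (f A B p : M) :
  is_function f A B -> (p ∈ f <-> exists x, x ∈ A /\ p = opair x (app f x)).
Proof.
  intro Hf. split.
  - intro Hp. destruct (proj1 Hf _ Hp) as (a & b & Ha & Hb & E).
    apply is_opair_iff in E. subst p. apply maps_iff in Hp.
    apply (function_maps f A B a b Hf) in Hp. destruct Hp as [_ ->]. eauto.
  - intros (x & Hx & ->). apply maps_iff. now apply (function_maps f A B).
Qed.

Lemma function_ext (f g A B B' : M) :
  is_function f A B -> is_function g A B' ->
  (forall x, x ∈ A -> app f x = app g x) -> f = g.
Proof.
  intros Hf Hg E. apply set_ext. intro p.
  rewrite (function_elements f A B p Hf), (function_elements g A B' p Hg).
  split; intros (x & Hx & ->); exists x; rewrite E; auto.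
Qed.

Definition graph (A : M) (F : M -> M) : M := image A (fun x => opair x (F x)).

Lemma maps_graph (A : M) (F : M -> M) (x y : M) :
  DefTerm (fun c : unit * M => F (snd c)) ->
  (maps (graph A F) x y <-> x ∈ A /\ y = F x).
Proof.
  intro HF. rewrite maps_iff. unfold graph. rewrite in_image by dfn. split.
  - intros (z & Hz & E). apply opair_inj in E as [-> ->]. tauto.
  - intros [Hx ->]. eauto.
Qed.

Lemma app_graph (A : M) (F : M -> M) (x : M) :
  DefTerm (fun c : unit * M => F (snd c)) -> x ∈ A -> app (graph A F) x = F x.
Proof.
  intros HF Hx. apply iota_unique.
  - now apply maps_iff, maps_graph.
  - intros z Hz. apply maps_iff, maps_graph in Hz; tauto.
Qed.

Definition maps_to (F : M -> M) (A B : M) : Prop := forall x, x ∈ A -> F x ∈ B.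
Definition inj_on (F : M -> M) (A : M) : Prop :=
  forall x x', x ∈ A -> x' ∈ A -> F x = F x' -> x = x'.
Definition onto (F : M -> M) (A B : M) : Prop :=
  forall y, y ∈ B -> exists x, x ∈ A /\ F x = y.

Lemma graph_function (A B : M) (F : M -> M) :
  DefTerm (fun c : unit * M => F (snd c)) -> maps_to F A B ->
  is_function (graph A F) A B.
Proof.
  intros HF HB. split.
  - intros p Hp. unfold graph in Hp. rewrite in_image in Hp by dfn.
    destruct Hp as (x & Hx & ->). exists x, (F x). rewrite is_opair_iff. auto.
  - intros x Hx. exists (F x). split.
    + now apply maps_graph.
    + intros y Hy. apply maps_graph in Hy; trivial. now symmetry.
Qed.

Lemma graph_injection (A B : M) (F : M -> M) :
  DefTerm (fun c : unit * M => F (snd c)) -> maps_to F A B -> inj_on F A ->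
  is_injection (graph A F) A B.
Proof.
  intros HF HB HI. split; [now apply graph_function|].
  intros x x' y K K'. apply maps_graph in K, K'; trivial.
  destruct K as [Hx ->], K' as [Hx' E]. auto.
Qed.

Lemma graph_surjection (A B : M) (F : M -> M) :
  DefTerm (fun c : unit * M => F (snd c)) -> maps_to F A B -> onto F A B ->
  is_surjection (graph A F) A B.
Proof.
  intros HF HB HI. split; [now apply graph_function|].
  intros y Hy. destruct (HI y Hy) as (x & Hx & <-). exists x.
  now apply maps_graph.
Qed.

Lemma card_le_of (A B : M) (F : M -> M) :
  DefTerm (fun c : unit * M => F (snd c)) -> maps_to F A B -> inj_on F A ->
  card_le A B.
Proof. intros. exists (graph A F). now apply graph_injection. Qed.

Lemma injection_app (f A B : M) :
  is_injection f A B -> maps_to (app f) A B /\ inj_on (app f) A.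
Proof.
  intros [Hf Hi]. split.
  - intros x. now apply function_app.
  - intros x x' Hx Hx' E. apply (Hi x x' (app f x)); apply (function_maps f A B _ _ Hf); auto.
Qed.

Lemma surjection_app (f A B : M) :
  is_surjection f A B -> maps_to (app f) A B /\ onto (app f) A B.
Proof.
  intros [Hf Hi]. split.
  - intros x. now apply function_app.
  - intros y Hy. destruct (Hi y Hy) as (x & Hx).
    apply (function_maps f A B _ _ Hf) in Hx. destruct Hx as [Hx ->]. eauto.
Qed.

Lemma card_le_app (A B : M) :
  card_le A B -> exists f, maps_to (app f) A B /\ inj_on (app f) A.
Proof. intros [f Hf]. exists f. now apply injection_app. Qed.

Lemma card_le_star_of (A B : M) (F : M -> M) :
  DefTerm (fun c : unit * M => F (snd c)) -> maps_to F A B -> onto F A B ->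
  card_le_star B A.
Proof. intros. left. exists (graph A F). now apply graph_surjection. Qed.

Lemma equinumerous_of (A B : M) (F : M -> M) :
  DefTerm (fun c : unit * M => F (snd c)) -> maps_to F A B -> inj_on F A ->
  onto F A B -> equinumerous A B.
Proof.
  intros. exists (graph A F). split; [now apply graph_injection | now apply graph_surjection].
Qed.

Lemma equinumerous_app (A B : M) :
  equinumerous A B -> exists f, maps_to (app f) A B /\ inj_on (app f) A /\ onto (app f) A B.
Proof.
  intros (f & Hi & Hs). exists f.
  apply injection_app in Hi. apply surjection_app in Hs. tauto.
Qed.

Lemma card_le_refl (A : M) : card_le A A.
Proof. apply (card_le_of A A (fun x => x)); [dfn|..]; unfold maps_to, inj_on; auto. Qed.

Lemma card_le_subset (A B : M) : subset A B -> card_le A B.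
Proof. intro H. apply (card_le_of A B (fun x => x)); [dfn|..]; unfold maps_to, inj_on; auto. Qed.

Lemma card_le_trans (A B C : M) : card_le A B -> card_le B C -> card_le A C.
Proof.
  intros H K. apply card_le_app in H as (f & Hf & If), K as (g & Hg & Ig).
  apply (card_le_of A C (fun x => app g (app f x))); [dfn|..].
  - intros x Hx. auto.
  - intros x x' Hx Hx' E. auto.
Qed.

Lemma equinumerous_sym (A B : M) : equinumerous A B -> equinumerous B A.
Proof.
  intro H. apply equinumerous_app in H as (f & Hf & If & Sf).
  assert (K : forall x, x ∈ A -> iota (fun z => z ∈ A /\ app f z = app f x) = x).
  { intros x Hx. apply iota_unique; [auto|]. intros z [Hz E]. auto. }
  apply (equinumerous_of B A (fun y => iota (fun x => x ∈ A /\ app f x = y))); [dfn|..].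
  - intros y Hy. destruct (Sf y Hy) as (x & Hx & <-). now rewrite K.
  - intros y y' Hy Hy'. destruct (Sf y Hy) as (x & Hx & <-).
    destruct (Sf y' Hy') as (x' & Hx' & <-). rewrite !K; congruence.
  - intros x Hx. exists (app f x). split; [auto | now apply K].
Qed.

Lemma equinumerous_card_le (A B : M) : equinumerous A B -> card_le A B.
Proof. intros (f & Hf & _). now exists f. Qed.

Lemma equinumerous_trans (A B C : M) :
  equinumerous A B -> equinumerous B C -> equinumerous A C.
Proof.
  intros H K. apply equinumerous_app in H as (f & Hf & If & Sf), K as (g & Hg & Ig & Sg).
  apply (equinumerous_of A C (fun x => app g (app f x))); [dfn|..].
  - intros x Hx. auto.
  - intros x x' Hx Hx' E. auto.
  - intros z Hz. destruct (Sg z Hz) as (y & Hy & <-).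
    destruct (Sf y Hy) as (x & Hx & <-). eauto.
Qed.

Lemma card_le_prod (A A' B B' : M) :
  card_le A A' -> card_le B B' -> card_le (prod A B) (prod A' B').
Proof.
  intros H K. apply card_le_app in H as (f & Hf & If), K as (g & Hg & Ig).
  apply (card_le_of _ _ (fun p => opair (app f (pr1 p)) (app g (pr2 p)))); [dfn|..].
  - intros p Hp. apply in_prod in Hp as (a & b & Ha & Hb & ->).
    rewrite pr1_opair, pr2_opair, in_prod_opair. auto.
  - intros p p' Hp Hp'. apply in_prod in Hp as (a & b & Ha & Hb & ->).
    apply in_prod in Hp' as (a' & b' & Ha' & Hb' & ->).
    rewrite !pr1_opair, !pr2_opair. intro E. apply opair_inj in E as [E1 E2].
    f_equal; auto.
Qed.

Lemma card_le_star_trans (A B C : M) :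
  card_le_star A B -> card_le_star B C -> card_le_star A C.
Proof.
  intros [[f Hf]|HA]; [|now right]. apply surjection_app in Hf as [Hf Sf].
  intros [[g Hg]|HB].
  - apply surjection_app in Hg as [Hg Sg].
    apply (card_le_star_of C A (fun x => app f (app g x))); [dfn|..].
    + intros x Hx. auto.
    + intros z Hz. destruct (Sf z Hz) as (y & Hy & <-).
      destruct (Sg y Hy) as (x & Hx & <-). eauto.
  - right. intros z Hz. destruct (Sf z Hz) as (y & Hy & _). now apply (HB y).
Qed.

Definition ite (P : Prop) (a b : M) : M := iota (fun y => (P /\ y = a) \/ (~ P /\ y = b)).

#[global] Instance def_ite {C} {HC : Ctx M C} (P : C -> Prop) (t u : C -> M) :
  Definable P -> DefTerm t -> DefTerm u -> DefTerm (fun c => ite (P c) (t c) (u c)).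
Proof. intros HP ? ?. apply definable_weaken in HP. unfold ite. dfn. Qed.

Lemma ite_true (P : Prop) (a b : M) : P -> ite P a b = a.
Proof. intro H. apply iota_unique; tauto. Qed.

Lemma ite_false (P : Prop) (a b : M) : ~ P -> ite P a b = b.
Proof. intro H. apply iota_unique; tauto. Qed.

Lemma card_le_star_of_partial (A B b : M) (F : M -> M) :
  DefTerm (fun c : unit * M => F (snd c)) -> b ∈ B ->
  onto F A B -> card_le_star B A.
Proof.
  intros HF Hb HS.
  apply (card_le_star_of A B (fun x => ite (F x ∈ B) (F x) b)); [dfn|..].
  - intros x Hx. destruct (classic (F x ∈ B)); [rewrite ite_true | rewrite ite_false]; auto.
  - intros y Hy. destruct (HS y Hy) as (x & Hx & E). exists x. split; trivial.
    rewrite ite_true; trivial. now rewrite E.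
Qed.

Lemma card_le_star_of_card_le (A B : M) : card_le A B -> card_le_star A B.
Proof.
  intro H. destruct (classic (nonempty A)) as [[a Ha]|N].
  - apply card_le_app in H as (f & Hf & If).
    assert (K : forall x, x ∈ A -> iota (fun z => z ∈ A /\ app f z = app f x) = x).
    { intros x Hx. apply iota_unique; [auto|]. intros z [Hz E]. auto. }
    apply (card_le_star_of_partial B A a (fun y => iota (fun x => x ∈ A /\ app f x = y)));
      [dfn | trivial |].
    intros x Hx. exists (app f x). auto.
  - right. intros z Hz. apply N. now exists z.
Qed.

Definition dom (f : M) : M := image f pr1.

#[global] Instance def_dom {C} {HC : Ctx M C} (t : C -> M) :
  DefTerm t -> DefTerm (fun c => dom (t c)).
Proof. intros. unfold dom. dfn. Qed.

Lemma dom_function (f A B : M) : is_function f A B -> dom f = A.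
Proof.
  intro Hf. apply set_ext. intro x. unfold dom. rewrite in_image by dfn. split.
  - intros (p & Hp & ->). apply (function_elements f A B p Hf) in Hp.
    destruct Hp as (y & Hy & ->). now rewrite pr1_opair.
  - intro Hx. exists (opair x (app f x)). rewrite pr1_opair. split; trivial.
    apply (function_elements f A B _ Hf). eauto.
Qed.

End Functions.
#[global] Typeclasses Opaque emptyset union cup succ opair pr1 pr2 prod app ite dom.

(** * Ordinals *)

Section Ordinals.
Context {M : set_structure} {HM : ZF M}.

Lemma minimal_element (s : M) :
  nonempty s -> exists m, m ∈ s /\ forall z, z ∈ m -> ~ z ∈ s.
Proof. apply (zf_foundation M HM). Qed.

Lemma mem_irrefl (x : M) : ~ x ∈ x.
Proof.
  intro H. destruct (minimal_element (upair x x)) as (m & Hm & K).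
  - exists x. apply in_upair. tauto.
  - apply in_upair in Hm. assert (m = x) by tauto. subst m.
    apply (K x H), in_upair. tauto.
Qed.

Lemma mem_asym (x y : M) : x ∈ y -> ~ y ∈ x.
Proof.
  intros H H'. destruct (minimal_element (upair x y)) as (m & Hm & K).
  - exists x. apply in_upair. tauto.
  - apply in_upair in Hm. destruct Hm as [-> | ->].
    + apply (K y H'), in_upair. tauto.
    + apply (K x H), in_upair. tauto.
Qed.

Lemma mem_no_3cycle (x y z : M) : x ∈ y -> y ∈ z -> ~ z ∈ x.
Proof.
  intros H1 H2 H3. destruct (minimal_element (cup (upair x y) (upair z z))) as (m & Hm & K).
  - exists x. rewrite in_cup, in_upair. tauto.
  - rewrite in_cup, !in_upair in Hm.
    assert (E : m = x \/ m = y \/ m = z) by tauto. clear Hm.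
    destruct E as [-> | [-> | ->]].
    + apply (K z H3). rewrite in_cup, !in_upair. tauto.
    + apply (K x H1). rewrite in_cup, !in_upair. tauto.
    + apply (K y H2). rewrite in_cup, !in_upair. tauto.
Qed.

(** By Foundation, the well-ordering clauses in the definition of an ordinal reduce
    to comparability. *)
Lemma ordinal_intro (x : M) :
  transitive_set x ->
  (forall a b, a ∈ x -> b ∈ x -> a ∈ b \/ a = b \/ b ∈ a) ->
  ordinal x.
Proof.
  intros T L. split; [exact T|]. split; [|split; [|split]].
  - intros a _. apply mem_irrefl.
  - intros a b c Ha Hb Hc Hab Hbc. destruct (L a c Ha Hc) as [K|[->|K]]; trivial.
    + destruct (mem_asym b c Hbc Hab).
    + destruct (mem_no_3cycle a b c Hab Hbc K).
  - exact L.
  - intros s Hs Ns. destruct (minimal_element s Ns) as (m & Hm & K). exists m.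
    split; trivial. intros a Ha. destruct (L m a (Hs _ Hm) (Hs _ Ha)) as [E|[E|E]]; auto.
    destruct (K a E Ha).
Qed.

Lemma ordinal_trans (x y z : M) : ordinal x -> y ∈ x -> z ∈ y -> z ∈ x.
Proof. intros [T _] Hy. now apply T. Qed.

Lemma ordinal_total (x a b : M) :
  ordinal x -> a ∈ x -> b ∈ x -> a ∈ b \/ a = b \/ b ∈ a.
Proof. intros (_ & _ & _ & L & _). apply L. Qed.

Lemma ordinal_mem (x y : M) : ordinal x -> y ∈ x -> ordinal y.
Proof.
  intros Hx Hy. apply ordinal_intro.
  - intros a Ha b Hb.
    assert (a ∈ x) by eauto using ordinal_trans.
    assert (b ∈ x) by eauto using ordinal_trans.
    destruct (ordinal_total x b y) as [K|[->|K]]; trivial.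
    + destruct (mem_asym y a Hb Ha).
    + destruct (mem_no_3cycle b a y Hb Ha K).
  - intros a b Ha Hb. apply (ordinal_total x); eauto using ordinal_trans.
Qed.

Lemma ordinal_trichotomy (x y : M) : ordinal x -> ordinal y -> x ∈ y \/ x = y \/ y ∈ x.
Proof.
  intros Hx Hy.
  (* The common part of two ordinals is an element of each one that it differs from. *)
  set (i := sep x (fun z => z ∈ y)).
  assert (Hi : forall z, z ∈ i <-> z ∈ x /\ z ∈ y) by (intro z; unfold i; now rewrite in_sep by dfn).
  assert (K : forall u, ordinal u -> (forall z, z ∈ i -> z ∈ u) -> i = u \/ i ∈ u).
  { intros u Hu Hs. destruct (classic (exists z, z ∈ u /\ ~ z ∈ i)) as [(z0 & H0 & N0)|N].
    - right. destruct (minimal_element (sep u (fun z => ~ z ∈ i))) as (m & Hm & Km).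
      { exists z0. rewrite in_sep by dfn. tauto. }
      rewrite in_sep in Hm by dfn. destruct Hm as [Hm Nm].
      assert (E : i = m); [|now rewrite E].
      apply set_ext. intro z. split; intro Hz.
      + destruct (ordinal_total u z m) as [C|[->|C]]; auto; try contradiction.
        destruct Nm. apply Hi in Hz. apply Hi. split.
        * apply (ordinal_trans x z); tauto.
        * apply (ordinal_trans y z); tauto.
      + apply NNPP. intro Nz. apply (Km z Hz). rewrite in_sep by dfn. split; trivial.
        now apply (ordinal_trans u m).
    - left. apply set_ext. intro z. split; auto. intro Hz. apply NNPP. eauto. }
  destruct (K x Hx) as [E|E]; [intros z Hz; now apply Hi| |];
  (destruct (K y Hy) as [E'|E']; [intros z Hz; now apply Hi| |]).
  - right. left. congruence.
  - left. now rewrite <- E.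
  - right. right. now rewrite <- E'.
  - destruct (mem_irrefl i). now apply Hi.
Qed.

Lemma ordinal_least (P : M -> Prop) :
  Definable (fun c : unit * M => P (snd c)) ->
  (exists x, ordinal x /\ P x) -> exists x, least_ordinal P x.
Proof.
  intros HP (x & Hx & Px).
  destruct (classic (exists y, y ∈ x /\ P y)) as [(y & Hy & Py)|N].
  - destruct (minimal_element (sep x P)) as (m & Hm & Km).
    { exists y. now apply in_sep. }
    apply in_sep in Hm; trivial. destruct Hm as [Hm Pm]. exists m.
    split; [|split]; trivial. { now apply (ordinal_mem x). }
    intros z Hz Pz. destruct (ordinal_trichotomy m z) as [C|[C|C]]; trivial.
    + now apply (ordinal_mem x).
    + now left.
    + now right.
    + destruct (Km z C). apply in_sep; trivial. split; trivial.
      now apply (ordinal_trans x m).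
  - exists x. split; [|split]; trivial. intros y Hy Py.
    destruct (ordinal_trichotomy x y) as [C|[C|C]]; trivial; unfold ord_le; auto.
    destruct N. eauto.
Qed.

Lemma ordinal_induction (P : M -> Prop) :
  Definable (fun c : unit * M => P (snd c)) ->
  (forall x, ordinal x -> (forall y, y ∈ x -> P y) -> P x) ->
  forall x, ordinal x -> P x.
Proof.
  intros HP IH x Hx. apply NNPP. intro N.
  destruct (ordinal_least (fun y => ~ P y)) as (m & Hm & Pm & Km); [dfn|eauto|].
  apply Pm, IH; trivial. intros y Hy. apply NNPP. intro Ny.
  destruct (Km y) as [C|C]; eauto using ordinal_mem.
  - now apply (mem_asym m y).
  - subst. now apply (mem_irrefl y).
Qed.

Lemma least_ordinal_unique (P : M -> Prop) (x y : M) :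
  least_ordinal P x -> least_ordinal P y -> x = y.
Proof.
  intros (Hx & Px & Kx) (Hy & Py & Ky).
  destruct (Kx y Hy Py) as [C|C]; trivial.
  destruct (Ky x Hx Px) as [C'|C']; auto. destruct (mem_asym x y C C').
Qed.

Definition least (P : M -> Prop) : M := iota (least_ordinal P).

#[global] Instance def_least {C} {HC : Ctx M C} (P : C -> M -> Prop) :
  Definable (fun c : C * M => P (fst c) (snd c)) ->
  DefTerm (fun c => least (P c)).
Proof.
  intros HP. unfold least, least_ordinal.
  assert (K := definable_weaken_under _ HP). dfn.
Qed.

Lemma least_spec (P : M -> Prop) :
  Definable (fun c : unit * M => P (snd c)) ->
  (exists x, ordinal x /\ P x) -> least_ordinal P (least P).
Proof.
  intros HP E. destruct (ordinal_least P HP E) as [x Hx].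
  unfold least. rewrite (iota_unique _ x); trivial. intros z Hz.
  now apply (least_ordinal_unique P).
Qed.

Lemma ord_le_subset (x y : M) : ordinal x -> ordinal y -> (ord_le x y <-> subset x y).
Proof.
  intros Hx Hy. split.
  - intros [H| ->] z Hz; trivial. now apply (ordinal_trans y x).
  - intro H. destruct (ordinal_trichotomy x y) as [C|[C|C]]; trivial.
    + now left.
    + now right.
    + destruct (mem_irrefl y). now apply H.
Qed.

Lemma ord_le_refl (x : M) : ord_le x x.
Proof. now right. Qed.

Lemma ord_le_trans (x y z : M) : ordinal z -> ord_le x y -> ord_le y z -> ord_le x z.
Proof.
  intros Hz [H| ->] [K| ->]; unfold ord_le; auto. left. now apply (ordinal_trans z y).
Qed.

Lemma ord_lt_le_trans (x y z : M) : ordinal z -> x ∈ y -> ord_le y z -> x ∈ z.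
Proof. intros Hz H [K| ->]; trivial. now apply (ordinal_trans z y). Qed.

Lemma ord_le_lt_trans (x y z : M) : ordinal z -> ord_le x y -> y ∈ z -> x ∈ z.
Proof. intros Hz [K| ->] H; trivial. now apply (ordinal_trans z y). Qed.

Lemma ord_lt_or_le (x y : M) : ordinal x -> ordinal y -> x ∈ y \/ ord_le y x.
Proof.
  intros Hx Hy. destruct (ordinal_trichotomy x y) as [C|[C|C]]; unfold ord_le; auto.
Qed.

Lemma ord_le_not_lt (x y : M) : ord_le x y -> ~ y ∈ x.
Proof. intros [H| ->]; [now apply mem_asym | apply mem_irrefl]. Qed.

Lemma ord_le_succ (x y : M) : ord_le x y <-> x ∈ succ y.
Proof. unfold ord_le. now rewrite in_succ. Qed.

Lemma ordinal_of_ordinals (x : M) :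
  transitive_set x -> (forall y, y ∈ x -> ordinal y) -> ordinal x.
Proof.
  intros T H. apply ordinal_intro; trivial. intros a b Ha Hb.
  apply ordinal_trichotomy; auto.
Qed.

Lemma ordinal_union (A : M) : (forall y, y ∈ A -> ordinal y) -> ordinal (union A).
Proof.
  intro H. apply ordinal_of_ordinals.
  - intros y Hy z Hz. apply in_union in Hy as (w & Hw & Hy). apply in_union.
    exists w. split; trivial. apply (ordinal_trans w y); auto.
  - intros y Hy. apply in_union in Hy as (w & Hw & Hy). apply (ordinal_mem w); auto.
Qed.

Lemma ord_le_union (A x : M) :
  (forall y, y ∈ A -> ordinal y) -> x ∈ A -> ord_le x (union A).
Proof.
  intros H Hx. apply ord_le_subset; auto using ordinal_union.
  intros z Hz. apply in_union. eauto.
Qed.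

Lemma union_ord_le (A b : M) :
  (forall y, y ∈ A -> ordinal y) -> ordinal b ->
  (forall y, y ∈ A -> ord_le y b) -> ord_le (union A) b.
Proof.
  intros H Hb K. apply ord_le_subset; auto using ordinal_union.
  intros z Hz. apply in_union in Hz as (y & Hy & Hz).
  apply (ord_lt_le_trans z y b); auto.
Qed.

Lemma ordinal_succ (x : M) : ordinal x -> ordinal (succ x).
Proof.
  intro Hx. apply ordinal_of_ordinals.
  - intros y Hy z Hz. rewrite in_succ in *. left. destruct Hy as [Hy| ->]; trivial.
    now apply (ordinal_trans x y).
  - intros y Hy. apply in_succ in Hy as [Hy| ->]; trivial. now apply (ordinal_mem x).
Qed.

Lemma ordinal_empty : ordinal emptyset.
Proof.
  apply ordinal_of_ordinals; intros y Hy; destruct (not_in_empty y Hy).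
Qed.

Lemma empty_in_ordinal (x : M) : ordinal x -> nonempty x -> emptyset ∈ x.
Proof.
  intros Hx [y Hy]. destruct (ordinal_trichotomy emptyset x) as [C|[C|C]]; trivial.
  - apply ordinal_empty.
  - subst. destruct (not_in_empty y Hy).
  - destruct (not_in_empty x C).
Qed.

Lemma succ_le (x y : M) : ordinal x -> ordinal y -> x ∈ y -> ord_le (succ x) y.
Proof.
  intros Hx Hy H. apply ord_le_subset; auto using ordinal_succ.
  intros z Hz. apply in_succ in Hz as [Hz| ->]; trivial. now apply (ordinal_trans y x).
Qed.

Lemma ordinal_cup (x y : M) : ordinal x -> ordinal y -> ordinal (cup x y).
Proof.
  intros Hx Hy. apply ordinal_union. intros z Hz. apply in_upair in Hz as [-> | ->]; trivial.
Qed.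

(** The union of two ordinals is one of them, namely their maximum. *)
Lemma cup_mem (x y z : M) :
  ordinal x -> ordinal y -> x ∈ z -> y ∈ z -> cup x y ∈ z.
Proof.
  intros Hx Hy Kx Ky.
  assert (E : cup x y = x \/ cup x y = y).
  { destruct (ord_lt_or_le x y) as [H|H]; trivial.
    - right. apply set_ext. intro w. rewrite in_cup. split; [|tauto].
      intros [K|K]; trivial. now apply (ordinal_trans y x).
    - left. apply set_ext. intro w. rewrite in_cup. split; [|tauto].
      intros [K|K]; trivial. now apply (ord_lt_le_trans w y x). }
  destruct E as [-> | ->]; trivial.
Qed.

Lemma ord_le_cup_l (x y : M) : ordinal x -> ordinal y -> ord_le x (cup x y).
Proof.
  intros Hx Hy. apply ord_le_subset; auto using ordinal_cup.
  intros z Hz. apply in_cup. tauto.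
Qed.

Lemma ord_le_cup_r (x y : M) : ordinal x -> ordinal y -> ord_le y (cup x y).
Proof.
  intros Hx Hy. apply ord_le_subset; auto using ordinal_cup.
  intros z Hz. apply in_cup. tauto.
Qed.

(** * Well-orders and their order types *)

Definition seg (A R x : M) : M := sep A (fun y => opair y x ∈ R).

Lemma in_seg (A R x y : M) : y ∈ seg A R x <-> y ∈ A /\ opair y x ∈ R.
Proof. unfold seg. now rewrite in_sep by dfn. Qed.

Definition ord_iso (f A R o : M) : Prop :=
  ordinal o /\
  (forall x, x ∈ A -> app f x ∈ o) /\
  (forall y, y ∈ o -> exists x, x ∈ A /\ app f x = y) /\
  (forall x y, x ∈ A -> y ∈ A -> (opair x y ∈ R <-> app f x ∈ app f y)).

Lemma ord_iso_agree (f g A R o o' : M) :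
  ord_iso f A R o -> ord_iso g A R o' -> forall x, x ∈ A -> app f x = app g x.
Proof.
  intros (Ho & Mf & Sf & Of) (Ho' & Mg & Sg & Og).
  enough (K : forall a, ordinal a -> a ∈ o -> forall x, x ∈ A -> app f x = a -> app g x = a).
  { intros x Hx. symmetry. apply (K (app f x)); auto. apply (ordinal_mem o); auto. }
  apply (ordinal_induction (fun a => a ∈ o -> forall x, x ∈ A -> app f x = a -> app g x = a)).
  { dfn. }
  intros a _ IH Ha x Hx E. apply set_ext. intro b. split; intro Hb.
  - destruct (Sg b) as (y & Hy & <-). { apply (ordinal_trans o' (app g x)); auto. }
    assert (L : app f y ∈ a) by (rewrite <- E; apply Of, Og; trivial).
    rewrite (IH _ L (ordinal_trans _ _ _ Ho Ha L) y Hy eq_refl). trivial.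
  - assert (Hb' : b ∈ o) by now apply (ordinal_trans o a).
    destruct (Sf b Hb') as (y & Hy & Ey).
    rewrite <- (IH b Hb Hb' y Hy Ey). apply Og; trivial. apply Of; trivial. now rewrite Ey, E.
Qed.

Lemma ord_iso_unique (f g A R o o' : M) :
  ord_iso f A R o -> ord_iso g A R o' -> o = o'.
Proof.
  intros F G. assert (E := ord_iso_agree _ _ _ _ _ _ F G).
  destruct F as (Ho & Mf & Sf & Of), G as (Ho' & Mg & Sg & Og).
  apply set_ext. intro z. split; intro Hz.
  - destruct (Sf z Hz) as (x & Hx & <-). rewrite E; auto.
  - destruct (Sg z Hz) as (x & Hx & <-). rewrite <- E; auto.
Qed.

Definition otype (A R : M) : M := iota (fun o => exists f, ord_iso f A R o).

#[global] Instance def_otype {C} {HC : Ctx M C} (t u : C -> M) :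
  DefTerm t -> DefTerm u -> DefTerm (fun c => otype (t c) (u c)).
Proof. intros. unfold otype. dfn. Qed.

Lemma otype_eq (f A R o : M) : ord_iso f A R o -> otype A R = o.
Proof.
  intro F. apply iota_unique; [eauto|]. intros z [g G]. now apply (ord_iso_unique g f A R).
Qed.

Lemma ord_iso_seg (f A R o x : M) :
  (forall x y z, x ∈ A -> y ∈ A -> z ∈ A -> opair x y ∈ R -> opair y z ∈ R -> opair x z ∈ R) ->
  ord_iso f A R o -> x ∈ A -> ord_iso f (seg A R x) R (app f x).
Proof.
  intros T (Ho & Mf & Sf & Of) Hx. split; [|split; [|split]].
  - apply (ordinal_mem o); auto.
  - intros y Hy. apply in_seg in Hy as [Hy Hyx]. now apply Of.
  - intros b Hb. destruct (Sf b) as (y & Hy & <-). { apply (ordinal_trans o (app f x)); auto. }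
    exists y. split; trivial. apply in_seg. split; trivial. now apply Of.
  - intros y z Hy Hz. apply in_seg in Hy, Hz. apply Of; tauto.
Qed.

Definition well_order (A R : M) : Prop :=
  (forall x y z, x ∈ A -> y ∈ A -> z ∈ A -> opair x y ∈ R -> opair y z ∈ R -> opair x z ∈ R) /\
  (forall x y, x ∈ A -> y ∈ A -> opair x y ∈ R \/ x = y \/ opair y x ∈ R) /\
  (forall s, subset s A -> nonempty s ->
     exists m, m ∈ s /\ forall z, z ∈ s -> ~ opair z m ∈ R).

Lemma well_order_irrefl (A R x : M) : well_order A R -> x ∈ A -> ~ opair x x ∈ R.
Proof.
  intros (_ & _ & W) Hx. destruct (W (upair x x)) as (m & Hm & K).
  - intros z Hz. apply in_upair in Hz. assert (z = x) by tauto. now subst.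
  - exists x. apply in_upair. tauto.
  - apply in_upair in Hm. assert (m = x) by tauto. subst. apply K, in_upair. tauto.
Qed.

(** If all proper initial segments of [B] have an order type, these types form an
    ordinal, to which [B] is isomorphic. *)
Lemma otype_glue (A R B : M) :
  well_order A R -> subset B A ->
  (forall x y, x ∈ B -> y ∈ A -> opair y x ∈ R -> y ∈ B) ->
  (forall x, x ∈ B -> exists f o, ord_iso f (seg A R x) R o) ->
  exists f o, ord_iso f B R o.
Proof.
  intros W HB IB H.
  assert (Wi := fun x => well_order_irrefl A R x W). destruct W as (T & L & _).
  set (h := fun x => otype (seg A R x) R).
  assert (Dh : DefTerm (fun c : unit * M => h (snd c))) by (unfold h; dfn).
  assert (Hh : forall x, x ∈ B -> exists f, ord_iso f (seg A R x) R (h x)).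
  { intros x Hx. destruct (H x Hx) as (f & o & F). exists f. unfold h.
    now rewrite (otype_eq _ _ _ _ F). }
  assert (Tseg : forall x, x ∈ A -> forall y, y ∈ seg A R x -> seg (seg A R x) R y = seg A R y).
  { intros x Hx y Hy. apply in_seg in Hy as [Hy Hyx].
    apply set_ext. intro z. rewrite !in_seg. split; [tauto|]. intros [Hz Hzy].
    repeat split; trivial. now apply (T z y x). }
  assert (Hf : forall x f, x ∈ B -> ord_iso f (seg A R x) R (h x) ->
    forall y, y ∈ seg A R x -> app f y = h y).
  { intros x f Hx F y Hy. symmetry. apply (otype_eq f).
    rewrite <- (Tseg x (HB _ Hx) y Hy). apply (ord_iso_seg f _ R (h x)); trivial.
    intros a b c Ha Hb Hc. apply in_seg in Ha, Hb, Hc. apply T; tauto. }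
  assert (Hlt : forall x y, x ∈ B -> y ∈ B -> opair y x ∈ R -> h y ∈ h x).
  { intros x y Hx Hy K. destruct (Hh x Hx) as [f F].
    assert (y ∈ seg A R x) by (apply in_seg; auto).
    rewrite <- (Hf x f Hx F y); trivial. now apply F. }
  exists (graph B h), (image B h).
  assert (E : forall x, x ∈ B -> app (graph B h) x = h x) by (intros; now apply app_graph).
  split; [|split; [|split]].
  - apply ordinal_of_ordinals.
    + intros u Hu v Hv. rewrite in_image in Hu by dfn. destruct Hu as (x & Hx & ->).
      destruct (Hh x Hx) as [f F].
      destruct (proj1 (proj2 (proj2 F)) v Hv) as (y & Hy & <-). apply in_image; [dfn|].
      exists y. split.
      * apply in_seg in Hy as []. apply (IB x); trivial.
      * now apply (Hf x f Hx).
    + intros u Hu. rewrite in_image in Hu by dfn. destruct Hu as (x & Hx & ->).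
      destruct (Hh x Hx) as [f F]. apply F.
  - intros x Hx. rewrite E; trivial. apply in_image; [dfn|]. eauto.
  - intros u Hu. rewrite in_image in Hu by dfn. destruct Hu as (x & Hx & ->). eauto.
  - intros x y Hx Hy. rewrite !E; trivial. split; [now apply Hlt|]. intro K.
    destruct (L x y) as [C|[C|C]]; auto.
    + subst. destruct (mem_irrefl _ K).
    + destruct (mem_asym _ _ K). now apply Hlt.
Qed.

Theorem well_order_iso (A R : M) : well_order A R -> exists f o, ord_iso f A R o.
Proof.
  intro W. apply (otype_glue A R A W); [intros z; auto | auto |].
  intros x Hx. apply NNPP. intro N.
  destruct (proj2 (proj2 W) (sep A (fun x => ~ exists f o, ord_iso f (seg A R x) R o)))
    as (m & Hm & Km).
  - intros z Hz. rewrite in_sep in Hz by dfn. tauto.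
  - exists x. rewrite in_sep by dfn. tauto.
  - rewrite in_sep in Hm by dfn. destruct Hm as [Hm Nm]. apply Nm.
    apply (otype_glue A R); trivial.
    + intros z Hz. now apply in_seg in Hz as [].
    + intros y z Hy Hz K. apply in_seg in Hy as [Hy Hym]. apply in_seg. split; trivial.
      now apply (proj1 W z y m).
    + intros y Hy. apply in_seg in Hy as [Hy Hym]. apply NNPP. intro Ny.
      apply (Km y); trivial. rewrite in_sep by dfn. tauto.
Qed.

End Ordinals.
#[global] Typeclasses Opaque least otype.

Section Cardinals.
Context {M : set_structure} {HM : ZF M}.

Definition memrel (S : M) : M := sep (prod S S) (fun p => pr1 p ∈ pr2 p).

Lemma in_memrel (S x y : M) : opair x y ∈ memrel S <-> x ∈ S /\ y ∈ S /\ x ∈ y.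
Proof.
  unfold memrel. rewrite in_sep by dfn. rewrite in_prod_opair, pr1_opair, pr2_opair. tauto.
Qed.

Definition ords (S : M) : Prop := forall x, x ∈ S -> ordinal x.

Lemma ords_ordinal (a : M) : ordinal a -> ords a.
Proof. intros Ha x. now apply ordinal_mem. Qed.

Lemma ords_subset (S S' : M) : ords S' -> subset S S' -> ords S.
Proof. intros H K x Hx. auto. Qed.

Lemma memrel_well_order (S : M) : ords S -> well_order S (memrel S).
Proof.
  intro H. split; [|split].
  - intros x y z Hx Hy Hz. rewrite !in_memrel. intros (_ & _ & K1) (_ & _ & K2).
    repeat split; trivial. apply (ordinal_trans z y x); auto.
  - intros x y Hx Hy. rewrite !in_memrel.
    destruct (ordinal_trichotomy x y) as [C|[C|C]]; auto.
  - intros s Hs Ns. destruct (minimal_element s Ns) as (m & Hm & K). exists m.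
    split; trivial. intros z Hz. rewrite in_memrel. intros (_ & _ & L). now apply (K z).
Qed.

Definition otp (S : M) : M := otype S (memrel S).
Definition below (S a : M) : M := sep S (fun x => x ∈ a).
(** The position of [a] in [S]: the value at [a] of the collapse of [S], obtained as
    an order type without mentioning the isomorphism. *)
Definition idx (S a : M) : M := otp (below S a).

#[global] Instance def_otp {C} {HC : Ctx M C} (t : C -> M) :
  DefTerm t -> DefTerm (fun c => otp (t c)).
Proof. intros. unfold otp. dfn. Qed.

#[global] Instance def_below {C} {HC : Ctx M C} (t u : C -> M) :
  DefTerm t -> DefTerm u -> DefTerm (fun c => below (t c) (u c)).
Proof. intros. unfold below. dfn. Qed.

#[global] Instance def_idx {C} {HC : Ctx M C} (t u : C -> M) :
  DefTerm t -> DefTerm u -> DefTerm (fun c => idx (t c) (u c)).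
Proof. intros. unfold idx. dfn. Qed.

Lemma in_below (S a x : M) : x ∈ below S a <-> x ∈ S /\ x ∈ a.
Proof. unfold below. now rewrite in_sep by dfn. Qed.

Lemma otp_iso (S : M) :
  ords S -> exists f, ord_iso f S (memrel S) (otp S) /\
    forall a, a ∈ S -> app f a = idx S a.
Proof.
  intro H. assert (W := memrel_well_order S H).
  destruct (well_order_iso S (memrel S) W) as (f & o & F).
  unfold otp at 1. rewrite (otype_eq f S (memrel S) o F). exists f. split; trivial.
  intros a Ha. assert (K := ord_iso_seg f S (memrel S) o a (proj1 W) F Ha).
  assert (E : seg S (memrel S) a = below S a).
  { apply set_ext. intro z. rewrite in_seg, in_memrel, in_below. tauto. }
  rewrite E in K. unfold idx, otp. symmetry. apply (otype_eq f).
  destruct K as (K1 & K2 & K3 & K4). split; [|split; [|split]]; trivial.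
  intros x y Hx Hy. rewrite <- K4; trivial. rewrite !in_memrel.
  apply in_below in Hx as [], Hy as []. rewrite !in_below. tauto.
Qed.

Lemma otp_ordinal (S : M) : ords S -> ordinal (otp S).
Proof. intro H. destruct (otp_iso S H) as (f & F & _). apply F. Qed.

Lemma idx_mem (S a : M) : ords S -> a ∈ S -> idx S a ∈ otp S.
Proof.
  intros H Ha. destruct (otp_iso S H) as (f & F & E). rewrite <- E; trivial. now apply F.
Qed.

Lemma idx_onto (S i : M) : ords S -> i ∈ otp S -> exists a, a ∈ S /\ idx S a = i.
Proof.
  intros H Hi. destruct (otp_iso S H) as (f & F & E).
  destruct (proj1 (proj2 (proj2 F)) i Hi) as (a & Ha & <-). exists a. now rewrite E.
Qed.

Lemma idx_lt (S a b : M) : ords S -> a ∈ S -> b ∈ S -> a ∈ b -> idx S a ∈ idx S b.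
Proof.
  intros H Ha Hb K. destruct (otp_iso S H) as (f & F & E). rewrite <- !E; trivial.
  apply F; trivial. now apply in_memrel.
Qed.

Lemma idx_inj (S : M) : ords S -> inj_on (idx S) S.
Proof.
  intros H a b Ha Hb E.
  destruct (ordinal_trichotomy a b) as [C|[C|C]]; auto;
    apply (idx_lt S) in C; trivial; rewrite E in C; destruct (mem_irrefl _ C).
Qed.

(** By induction on a bound [t] of [S']: the positions in [S] and in [S'] are themselves
    order types of smaller sets. *)
Lemma otp_mono (S S' : M) : ords S' -> subset S S' -> ord_le (otp S) (otp S').
Proof.
  intros H HS.
  set (t := union (image S' succ)).
  enough (K : forall t, ordinal t -> forall S S', subset S' t -> subset S S' ->
            ord_le (otp S) (otp S')).
  { apply (K t); trivial.
    - apply ordinal_union. intros y Hy. rewrite in_image in Hy by dfn.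
      destruct Hy as (x & Hx & ->). apply ordinal_succ. auto.
    - intros x Hx. apply in_union. exists (succ x). rewrite in_image by dfn.
      rewrite in_succ. eauto. }
  clear. intros t Ht. pattern t. revert t Ht. apply ordinal_induction.
  { unfold subset. dfn. }
  intros t Ht IH S S' H' H.
  assert (O' : ords S') by (intros x Hx; apply (ordinal_mem t); auto).
  assert (O : ords S) by now apply (ords_subset S S').
  apply ord_le_subset; auto using otp_ordinal.
  intros i Hi. destruct (idx_onto S i O Hi) as (a & Ha & <-).
  apply (ord_le_lt_trans _ (idx S' a)); auto using otp_ordinal, idx_mem.
  apply (IH a); auto.
  - intros x Hx. now apply in_below in Hx.
  - intros x Hx. rewrite in_below in *. split; [apply H|]; tauto.
Qed.

Lemma otp_of_ordinal (t : M) : ordinal t -> otp t = t.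
Proof.
  intro Ht. apply (otype_eq (graph t (fun x => x))).
  assert (E : forall x, x ∈ t -> app (graph t (fun x => x)) x = x).
  { intros. apply app_graph; trivial. dfn. }
  split; [|split; [|split]]; trivial.
  - intros x Hx. now rewrite E.
  - intros y Hy. exists y. now rewrite E.
  - intros x y Hx Hy. rewrite !E, in_memrel; tauto.
Qed.

Lemma otp_le (S t : M) : ordinal t -> subset S t -> ord_le (otp S) t.
Proof.
  intros Ht H. rewrite <- (otp_of_ordinal t Ht). apply otp_mono; trivial.
  now apply ords_ordinal.
Qed.

Lemma otp_equinumerous (S : M) : ords S -> equinumerous S (otp S).
Proof.
  intro H. apply (equinumerous_of _ _ (idx S)); [dfn|..].
  - intros a. now apply idx_mem.
  - now apply idx_inj.
  - intros i. now apply idx_onto.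
Qed.

(** * Cardinals *)

Lemma ord_le_card_le (a b : M) : ordinal a -> ordinal b -> ord_le a b -> card_le a b.
Proof. intros Ha Hb H. apply card_le_subset. now apply ord_le_subset. Qed.

Lemma card_le_ordinal (A a : M) :
  ordinal a -> card_le A a -> exists o, ordinal o /\ ord_le o a /\ equinumerous A o.
Proof.
  intros Ha H. apply card_le_app in H as (f & Mf & If).
  assert (Hs : subset (image A (app f)) a).
  { intros y Hy. rewrite in_image in Hy by dfn. destruct Hy as (x & Hx & ->). auto. }
  assert (O : ords (image A (app f))) by (apply (ords_subset _ a); auto using ords_ordinal).
  exists (otp (image A (app f))). split; [now apply otp_ordinal|].
  split; [now apply otp_le|].
  apply (equinumerous_trans _ (image A (app f))); [|now apply otp_equinumerous].
  apply (equinumerous_of _ _ (app f)); [dfn|..]; trivial.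
  - intros x Hx. rewrite in_image by dfn. eauto.
  - intros y Hy. rewrite in_image in Hy by dfn. destruct Hy as (x & Hx & ->). eauto.
Qed.

Lemma cardinal_not_card_le (k a : M) : cardinal k -> a ∈ k -> ~ card_le k a.
Proof.
  intros [Hk K] Ha H. apply card_le_ordinal in H as (o & Ho & Hoa & E).
  - apply (K o); [|now apply equinumerous_sym]. now apply (ord_le_lt_trans _ a).
  - now apply (ordinal_mem k).
Qed.

Lemma cardinal_card_le (k a : M) : cardinal k -> ordinal a -> card_le k a -> ord_le k a.
Proof.
  intros Hk Ha H. destruct (ord_lt_or_le a k) as [C|C]; trivial; [apply Hk|].
  destruct (cardinal_not_card_le k a Hk C H).
Qed.

Definition well_orderable (A : M) : Prop := exists a, ordinal a /\ card_le A a.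

Lemma well_orderable_ordinal (a : M) : ordinal a -> well_orderable a.
Proof. intro. exists a. auto using card_le_refl. Qed.

Lemma well_orderable_cardinality (A : M) :
  well_orderable A -> exists k, cardinal k /\ equinumerous A k.
Proof.
  intro W. destruct (ordinal_least (fun a => card_le A a)) as (k & Hk & Kk & Lk);
    [dfn | exact W |].
  destruct (card_le_ordinal A k Hk Kk) as (o & Ho & Hok & E).
  assert (o = k).
  { destruct Hok as [C|C]; trivial.
    destruct (ord_le_not_lt k o); trivial. apply Lk; trivial. now apply equinumerous_card_le. }
  subst o. exists k. split; trivial. split; trivial. intros x Hx K.
  apply (ord_le_not_lt k x); trivial. apply Lk; [now apply (ordinal_mem k)|].
  apply (card_le_trans _ k); trivial. now apply equinumerous_card_le, equinumerous_sym.
Qed.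

(** No choice is needed to invert a map on a well-orderable set. *)
Lemma card_le_image (A : M) (F : M -> M) :
  DefTerm (fun c : unit * M => F (snd c)) -> well_orderable A -> card_le (image A F) A.
Proof.
  intros HF (a & Ha & H). apply card_le_app in H as (f & Mf & If).
  set (G := fun y => iota (fun x => x ∈ A /\ F x = y /\
    forall x', x' ∈ A -> F x' = y -> ord_le (app f x) (app f x'))).
  assert (HG : forall y, y ∈ image A F -> G y ∈ A /\ F (G y) = y).
  { intros y Hy. rewrite in_image in Hy by dfn. destruct Hy as (x & Hx & ->).
    destruct (ordinal_least (fun i => exists z, z ∈ A /\ F z = F x /\ app f z = i))
      as (i & Hi & (z & Hz & E & <-) & L).
    { dfn. }
    { exists (app f x). split; [apply (ordinal_mem a); auto | eauto]. }
    assert (EG : G (F x) = z); [|now rewrite EG].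
    apply iota_unique.
    - split; [|split]; trivial. intros x' Hx' E'. apply L; [apply (ordinal_mem a); auto | eauto].
    - intros w (Hw & Ew & Lw). apply If; trivial.
      destruct (Lw z Hz E) as [C|C]; trivial.
      destruct (ord_le_not_lt (app f z) (app f w)); trivial.
      apply L; [apply (ordinal_mem a); auto | eauto]. }
  apply (card_le_of _ _ G); [unfold G; dfn|..].
  - intros y Hy. now apply HG.
  - intros y y' Hy Hy' E. apply HG in Hy as [_ <-], Hy' as [_ <-]. now rewrite E.
Qed.

(** For a cardinal [t]: [A] is well-orderable and has fewer than [t] elements. *)
Definition small (t A : M) : Prop := exists a, a ∈ t /\ card_le A a.

#[global] Instance definable_small {C} {HC : Ctx M C} (t u : C -> M) :
  DefTerm t -> DefTerm u -> Definable (fun c => small (t c) (u c)).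
Proof. intros. unfold small. dfn. Qed.

Lemma small_mono (t A B : M) : card_le A B -> small t B -> small t A.
Proof. intros H (a & Ha & K). exists a. split; trivial. now apply (card_le_trans _ B). Qed.

Lemma small_subset (t A B : M) : subset A B -> small t B -> small t A.
Proof. intro H. now apply small_mono, card_le_subset. Qed.

Lemma small_mem (t a : M) : a ∈ t -> small t a.
Proof. intro H. exists a. auto using card_le_refl. Qed.

Lemma small_well_orderable (t A : M) : ordinal t -> small t A -> well_orderable A.
Proof. intros Ht (a & Ha & H). exists a. split; trivial. now apply (ordinal_mem t). Qed.

Lemma cardinal_not_small (k A : M) : cardinal k -> card_le k A -> ~ small k A.
Proof.
  intros Hk H (a & Ha & K). apply (cardinal_not_card_le k a Hk Ha).
  now apply (card_le_trans _ A).
Qed.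

Lemma small_image (t A : M) (F : M -> M) :
  DefTerm (fun c : unit * M => F (snd c)) -> ordinal t -> small t A -> small t (image A F).
Proof.
  intros HF Ht H. apply (small_mono _ _ A); trivial. apply card_le_image; trivial.
  now apply (small_well_orderable t).
Qed.

Lemma small_onto (t A B : M) (F : M -> M) :
  DefTerm (fun c : unit * M => F (snd c)) -> ordinal t -> onto F A B ->
  small t A -> small t B.
Proof.
  intros HF Ht H K. apply (small_subset t B (image A F)).
  - intros y Hy. destruct (H y Hy) as (x & Hx & <-). rewrite in_image by dfn. eauto.
  - now apply small_image.
Qed.

Lemma small_otp (t S : M) :
  cardinal t -> subset S t -> (small t S <-> otp S ∈ t).
Proof.
  intros Ht H. assert (O : ords S) by (apply (ords_subset _ t); trivial; apply ords_ordinal, Ht).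
  assert (E := otp_equinumerous S O). split.
  - intro K. destruct (otp_le S t (proj1 Ht) H) as [C|C]; trivial.
    rewrite C in E. destruct (cardinal_not_small t S Ht); trivial.
    now apply equinumerous_card_le, equinumerous_sym.
  - intro K. exists (otp S). split; trivial. now apply equinumerous_card_le.
Qed.

Lemma cardinal_eq_of_card_le (A k : M) :
  cardinal k -> card_le A k -> card_le k A -> equinumerous A k.
Proof.
  intros Hk H K. apply card_le_ordinal in H as (o & Ho & [C|C] & E); [|now subst|apply Hk].
  destruct (cardinal_not_small k A Hk K). exists o. split; trivial.
  now apply equinumerous_card_le.
Qed.

(** * Hartogs and Lindenbaum numbers *)

Lemma ordinals_not_set (T : M) : exists a, ordinal a /\ ~ a ∈ T.
Proof.
  set (S := sep T ordinal).
  assert (O : ords S) by (intros x Hx; unfold S in Hx; rewrite in_sep in Hx by dfn; tauto).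
  exists (succ (union S)).
  assert (H : ordinal (succ (union S))) by now apply ordinal_succ, ordinal_union.
  split; trivial. intro K. assert (L : succ (union S) ∈ S).
  { unfold S at 2. rewrite in_sep by dfn. tauto. }
  apply (ord_le_union S _ O) in L. apply (ord_le_not_lt _ _ L). apply in_succ. tauto.
Qed.

(** Every ordinal that injects into [Z] is the order type of a relation on a subset
    of [Z], and these relations form a set. *)
Lemma ex_hartogs (Z : M) : exists h, is_hartogs Z h.
Proof.
  destruct (ordinals_not_set
    (image (prod (pow Z) (pow (prod Z Z))) (fun p => otype (pr1 p) (pr2 p))))
    as (h & Hh & Nh).
  apply ordinal_least; [dfn|]. exists h. split; trivial. intro K. apply Nh.
  apply card_le_app in K as (f & Mf & If). rewrite in_image by dfn.
  set (A := image h (app f)).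
  assert (HA : forall y, y ∈ A <-> exists a, a ∈ h /\ y = app f a).
  { intro y. unfold A. now rewrite in_image by dfn. }
  set (R := sep (prod Z Z) (fun p => exists a b, a ∈ h /\ b ∈ h /\ a ∈ b /\
    p = opair (app f a) (app f b))).
  exists (opair A R). rewrite pr1_opair, pr2_opair, in_prod_opair, !in_pow. split.
  - split.
    + intros y Hy. apply HA in Hy as (a & Ha & ->). auto.
    + intros p Hp. unfold R in Hp. rewrite in_sep in Hp by dfn. tauto.
  - symmetry. set (g := fun y => iota (fun a => a ∈ h /\ app f a = y)).
    assert (Dg : DefTerm (fun c : unit * M => g (snd c))) by (unfold g; dfn).
    assert (Hg : forall a, a ∈ h -> g (app f a) = a).
    { intros a Ha. apply iota_unique; [auto|]. intros z [Hz E]. auto. }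
    assert (Eg : forall a, a ∈ h -> app (graph A g) (app f a) = a).
    { intros a Ha. rewrite app_graph; [auto|dfn|]. apply HA. eauto. }
    apply (otype_eq (graph A g)). split; [|split; [|split]]; trivial.
    + intros x Hx. apply HA in Hx as (a & Ha & ->). now rewrite Eg.
    + intros a Ha. exists (app f a). rewrite Eg, HA; eauto.
    + intros x y Hx Hy. apply HA in Hx as (a & Ha & ->), Hy as (b & Hb & ->).
      rewrite !Eg; trivial. unfold R. rewrite in_sep by dfn. rewrite in_prod_opair. split.
      * intros (_ & a' & b' & Ha' & Hb' & K & E). apply opair_inj in E as [E1 E2].
        apply If in E1; trivial. apply If in E2; trivial. now subst.
      * intro K. split; [auto|]. exists a, b. auto.
Qed.

(** Distinct points have disjoint, nonempty fibers. *)
Lemma card_le_pow_of_star (A Z : M) : card_le_star A Z -> card_le A (pow Z).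
Proof.
  intros [[f Hf]|H].
  - apply surjection_app in Hf as [Mf Sf].
    apply (card_le_of _ _ (fun a => sep Z (fun z => app f z = a))); [dfn|..].
    + intros a Ha. apply in_pow. intros z Hz. rewrite in_sep in Hz by dfn. tauto.
    + intros a b Ha Hb E. destruct (Sf a Ha) as (z & Hz & K).
      assert (L : z ∈ sep Z (fun z => app f z = a)) by (rewrite in_sep by dfn; auto).
      rewrite E in L. rewrite in_sep in L by dfn. destruct L. congruence.
  - apply (card_le_of _ _ (fun a => a)); [dfn|intros x Hx|intros x x' Hx]; destruct (H x Hx).
Qed.

Lemma ex_lindenbaum (Z : M) : exists l, is_lindenbaum Z l.
Proof.
  destruct (ex_hartogs (pow Z)) as (h & Hh & Nh & _).
  apply ordinal_least; [dfn|]. exists h. split; trivial. intro K.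
  now apply Nh, card_le_pow_of_star.
Qed.

Lemma lt_hartogs (Z h a : M) : is_hartogs Z h -> ordinal a -> (a ∈ h <-> card_le a Z).
Proof.
  intros (Hh & Nh & L) Ha. split.
  - intro H. apply NNPP. intro N. apply (ord_le_not_lt h a); trivial. now apply L.
  - intro H. destruct (ord_lt_or_le a h) as [C|C]; trivial. destruct Nh.
    apply (card_le_trans _ a); trivial. now apply ord_le_card_le.
Qed.

Lemma lt_lindenbaum (Z l a : M) : is_lindenbaum Z l -> ordinal a -> (a ∈ l <-> card_le_star a Z).
Proof.
  intros (Hh & Nh & L) Ha. split.
  - intro H. apply NNPP. intro N. apply (ord_le_not_lt l a); trivial. now apply L.
  - intro H. destruct (ord_lt_or_le a l) as [C|C]; trivial. destruct Nh.
    apply (card_le_star_trans _ a); trivial.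
    now apply card_le_star_of_card_le, ord_le_card_le.
Qed.

Lemma hartogs_cardinal (Z h : M) : is_hartogs Z h -> cardinal h.
Proof.
  intro H. split; [apply H|]. intros a Ha E. apply H.
  apply (card_le_trans _ a); [now apply equinumerous_card_le, equinumerous_sym|].
  apply (lt_hartogs Z h); trivial. apply (ordinal_mem h); trivial. apply H.
Qed.

Lemma lindenbaum_cardinal (Z l : M) : is_lindenbaum Z l -> cardinal l.
Proof.
  intro H. split; [apply H|]. intros a Ha E. apply H.
  apply (card_le_star_trans _ a).
  - now apply card_le_star_of_card_le, equinumerous_card_le, equinumerous_sym.
  - apply (lt_lindenbaum Z l); trivial. apply (ordinal_mem l); trivial. apply H.
Qed.

Lemma card_succ_of_hartogs (k h : M) : cardinal k -> is_hartogs k h -> is_card_succ k h.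
Proof.
  intros Hk H. split; [apply H|]. split.
  - split; [now apply (hartogs_cardinal k)|]. apply (lt_hartogs k h); trivial.
    + apply Hk.
    + apply card_le_refl.
  - intros y Hy [Cy Ky]. destruct (ord_lt_or_le y h) as [C|C]; trivial; [apply H|].
    apply (lt_hartogs k h) in C; trivial. destruct (cardinal_not_card_le y k); trivial.
Qed.

End Cardinals.
#[global] Typeclasses Opaque otp below idx small.

(** * Products of infinite cardinals *)

Section Products.
Context {M : set_structure} {HM : ZF M}.

Definition limit (w : M) : Prop :=
  ordinal w /\ nonempty w /\ forall a, a ∈ w -> succ a ∈ w.

Lemma succ_inj (x y : M) : succ x = succ y -> x = y.
Proof.
  intro E.
  assert (Hx : x ∈ succ y) by (rewrite <- E; apply in_succ; tauto).
  assert (Hy : y ∈ succ x) by (rewrite E; apply in_succ; tauto).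
  apply in_succ in Hx as [Hx| ->]; trivial. apply in_succ in Hy as [Hy| ->]; trivial.
  destruct (mem_asym x y Hx Hy).
Qed.

(** Shifting the elements of the limit ordinal [w] makes room for one more point. *)
Lemma card_le_succ (w a : M) : limit w -> ordinal a -> ord_le w a -> card_le (succ a) a.
Proof.
  intros (Ow & Nw & Sw) Oa H.
  assert (Hs : subset w a) by now apply ord_le_subset.
  assert (H0 := empty_in_ordinal w Ow Nw).
  set (F := fun x => ite (x = a) emptyset (ite (x ∈ w) (succ x) x)).
  assert (Fa : F a = emptyset) by now apply ite_true.
  assert (Fw : forall x, x ∈ a -> x ∈ w -> F x = succ x).
  { intros x Hx Hw. unfold F. rewrite ite_false, ite_true; trivial.
    intros ->. now apply (mem_irrefl a). }
  assert (Fn : forall x, x ∈ a -> ~ x ∈ w -> F x = x).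
  { intros x Hx Hw. unfold F. rewrite !ite_false; trivial.
    intros ->. now apply (mem_irrefl a). }
  assert (N : forall x, succ x <> emptyset).
  { intros x E. apply (not_in_empty x). rewrite <- E. apply in_succ. tauto. }
  apply (card_le_of _ _ F); [unfold F; dfn|..].
  - intros x Hx. apply in_succ in Hx as [Hx| ->].
    + destruct (classic (x ∈ w)) as [K|K]; [rewrite Fw | rewrite Fn]; auto.
    + rewrite Fa. auto.
  - assert (K : forall x, x ∈ a -> F x <> emptyset).
    { intros x Hx E. destruct (classic (x ∈ w)) as [K|K].
      - rewrite Fw in E; trivial. now apply (N x).
      - rewrite Fn in E; trivial. now subst. }
    intros x y Hx Hy E. apply in_succ in Hx as [Hx| ->], Hy as [Hy| ->]; trivial.
    + destruct (classic (x ∈ w)) as [Kx|Kx], (classic (y ∈ w)) as [Ky|Ky].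
      * rewrite !Fw in E; trivial. now apply succ_inj.
      * rewrite Fw, Fn in E; trivial. destruct Ky. rewrite <- E. auto.
      * rewrite Fn, Fw in E; trivial. destruct Kx. rewrite E. auto.
      * rewrite !Fn in E; trivial.
    + destruct (K x Hx). congruence.
    + destruct (K y Hy). congruence.
Qed.

(** For a cardinal, being closed under successors is the same as being infinite, by
    [card_le_succ]; closure is the form in which infinity is used. *)
Definition infinite_cardinal (k : M) : Prop := cardinal k /\ limit k.

Lemma infinite_cardinal_of_limit (w k : M) :
  limit w -> cardinal k -> ord_le w k -> infinite_cardinal k.
Proof.
  intros Hw Hk H. split; trivial. split; [apply Hk|].
  assert (Hs : subset w k) by (apply ord_le_subset; trivial; [apply Hw | apply Hk]).
  split.
  - destruct Hw as (_ & [x Hx] & _). exists x. auto.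
  - intros a Ha. assert (Oa : ordinal a) by (apply (ordinal_mem k); trivial; apply Hk).
    destruct (ord_lt_or_le a w) as [C|C]; trivial; [apply Hw| |].
    + apply Hs. now apply Hw.
    + destruct (succ_le a k) as [K|K]; trivial; [apply Hk|].
      destruct (cardinal_not_card_le k a Hk Ha). rewrite <- K. now apply (card_le_succ w).
Qed.

(** Being below every limit ordinal makes [omega] dispensable. *)
Definition finite (n : M) : Prop := ordinal n /\ forall w, limit w -> n ∈ w.

Lemma finite_induction (P : M -> Prop) :
  Definable (fun c : unit * M => P (snd c)) ->
  P emptyset -> (forall j, finite j -> P j -> P (succ j)) ->
  forall n, finite n -> P n.
Proof.
  intros HP H0 HS.
  enough (K : forall n, ordinal n -> finite n -> P n) by (intros n Hn; apply K; trivial; apply Hn).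
  apply (ordinal_induction (fun n => finite n -> P n)); [unfold finite; dfn|].
  intros n On IH Hn. destruct (classic (nonempty n)) as [N|N].
  - assert (E : exists j, j ∈ n /\ ~ succ j ∈ n).
    { apply NNPP. intro K. apply (mem_irrefl n). apply Hn.
      split; [|split]; trivial. intros a Ha. apply NNPP. eauto. }
    destruct E as (j & Hj & Nj). assert (Oj : ordinal j) by now apply (ordinal_mem n).
    destruct (succ_le j n) as [C|C]; trivial; [contradiction|].
    rewrite <- C. assert (Fj : finite j).
    { split; trivial. intros w Hw. apply (ordinal_trans w n); trivial; [apply Hw | now apply Hn]. }
    auto.
  - assert (E : n = emptyset); [|now rewrite E].
    apply set_ext. intro z. split; intro Hz; [destruct N; now exists z | destruct (not_in_empty z Hz)].
Qed.

Lemma small_add_point (k A x : M) :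
  infinite_cardinal k -> small k A -> small k (cup A (upair x x)).
Proof.
  intros Hk (a & Ha & H). apply card_le_app in H as (f & Mf & If).
  exists (succ a). split; [now apply Hk|].
  apply (card_le_of _ _ (fun y => ite (y ∈ A) (app f y) a)); [dfn|..].
  - intros y Hy. apply in_succ. destruct (classic (y ∈ A)).
    + rewrite ite_true; auto.
    + rewrite ite_false; auto.
  - intros y z Hy Hz. rewrite in_cup, in_upair in Hy, Hz.
    destruct (classic (y ∈ A)), (classic (z ∈ A));
      repeat first [rewrite ite_true by trivial | rewrite ite_false by trivial].
    + auto.
    + intro E. destruct (mem_irrefl a). rewrite <- E at 1. auto.
    + intro E. destruct (mem_irrefl a). rewrite E at 1. auto.
    + intros _. intuition congruence.
Qed.

Lemma small_cup_finite (k n : M) :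
  infinite_cardinal k -> finite n ->
  forall A B, small k A -> card_le B n -> small k (cup A B).
Proof.
  intros Hk Hn. revert n Hn.
  apply (finite_induction (fun n => forall A B, small k A -> card_le B n -> small k (cup A B)));
    [dfn|..].
  - intros A B HA H. apply card_le_app in H as (f & Mf & _).
    apply (small_subset k _ A); trivial. intros z Hz. apply in_cup in Hz as [Hz|Hz]; trivial.
    destruct (not_in_empty (app f z)). auto.
  - intros j _ IH A B HA H. apply card_le_app in H as (f & Mf & If).
    set (B' := sep B (fun x => app f x ∈ j)).
    assert (HB' : forall x, x ∈ B' <-> x ∈ B /\ app f x ∈ j).
    { intro x. unfold B'. now rewrite in_sep by dfn. }
    set (b := iota (fun x => x ∈ B /\ app f x = j)).
    apply (small_subset k _ (cup (cup A B') (upair b b))).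
    + intros x Hx. rewrite !in_cup, in_upair, HB'. rewrite in_cup in Hx.
      destruct Hx as [Hx|Hx]; [tauto|]. assert (K := Mf x Hx).
      apply in_succ in K as [K|K]; [tauto|]. right. left. symmetry.
      apply iota_unique; [tauto|]. intros z [Hz E]. apply If; congruence.
    + apply small_add_point; trivial. apply IH; trivial.
      apply (card_le_of _ _ (app f)); [dfn|..].
      * intros x Hx. now apply HB'.
      * intros x y Hx Hy. apply HB' in Hx as [], Hy as []. auto.
Qed.

Lemma small_square_finite (k n : M) :
  infinite_cardinal k -> finite n -> small k (prod n n).
Proof.
  intros Hk Hn.
  enough (K : forall j, finite j -> small k (prod n j)) by auto.
  apply (finite_induction (fun j => small k (prod n j))); [dfn|..].
  - exists emptyset. split; [apply empty_in_ordinal; apply Hk|].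
    apply card_le_subset. intros p Hp. apply in_prod in Hp as (a & b & _ & Hb & _).
    destruct (not_in_empty b Hb).
  - intros j _ IH.
    apply (small_subset k _ (cup (prod n j) (prod n (upair j j)))).
    + intros p Hp. apply in_prod in Hp as (a & b & Ha & Hb & ->).
      rewrite in_cup, !in_prod_opair, in_upair. apply in_succ in Hb. tauto.
    + apply (small_cup_finite k n); trivial.
      apply (card_le_of _ _ pr1); [dfn|..].
      * intros p Hp. apply in_prod in Hp as (a & b & Ha & Hb & ->). now rewrite pr1_opair.
      * intros p q Hp Hq. apply in_prod in Hp as (a & b & Ha & Hb & ->).
        apply in_prod in Hq as (a' & b' & Ha' & Hb' & ->). rewrite !pr1_opair.
        intros ->. apply in_upair in Hb, Hb'. f_equal. intuition congruence.
Qed.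

Definition lex (a b c a' b' c' : M) : Prop :=
  a ∈ a' \/ (a = a' /\ (b ∈ b' \/ (b = b' /\ c ∈ c'))).

Definition pmax (p : M) : M := cup (pr1 p) (pr2 p).

(** Gödel's well-order of the pairs of ordinals below [k]: by maximum, then
    lexicographically. *)
Definition goedel_order (k : M) : M :=
  sep (prod (prod k k) (prod k k)) (fun z =>
    lex (pmax (pr1 z)) (pr1 (pr1 z)) (pr2 (pr1 z))
        (pmax (pr2 z)) (pr1 (pr2 z)) (pr2 (pr2 z))).

Lemma in_goedel_order (k p q : M) :
  opair p q ∈ goedel_order k <->
  p ∈ prod k k /\ q ∈ prod k k /\
  lex (pmax p) (pr1 p) (pr2 p) (pmax q) (pr1 q) (pr2 q).
Proof.
  unfold goedel_order. rewrite in_sep by (unfold lex; dfn).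
  rewrite in_prod_opair, pr1_opair, pr2_opair. tauto.
Qed.

Lemma minimal_value (s : M) (F : M -> M) :
  DefTerm (fun c : unit * M => F (snd c)) -> nonempty s ->
  exists p, p ∈ s /\ forall z, z ∈ s -> ~ F z ∈ F p.
Proof.
  intros HF [x Hx]. destruct (minimal_element (image s F)) as (m & Hm & K).
  - exists (F x). rewrite in_image by dfn. eauto.
  - rewrite in_image in Hm by dfn. destruct Hm as (p & Hp & ->). exists p.
    split; trivial. intros z Hz Hlt. apply (K _ Hlt). rewrite in_image by dfn. eauto.
Qed.

Lemma goedel_well_order (k : M) : ordinal k -> well_order (prod k k) (goedel_order k).
Proof.
  intro Hk.
  assert (O : forall p, p ∈ prod k k -> ordinal (pr1 p) /\ ordinal (pr2 p) /\ ordinal (pmax p)).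
  { intros p Hp. apply in_prod in Hp as (a & b & Ha & Hb & ->).
    unfold pmax. rewrite pr1_opair, pr2_opair.
    assert (ordinal a) by now apply (ordinal_mem k).
    assert (ordinal b) by now apply (ordinal_mem k). auto using ordinal_cup. }
  split; [|split].
  - intros p q r Hp Hq Hr. rewrite !in_goedel_order. intros (_ & _ & K) (_ & _ & L).
    repeat split; trivial. apply O in Hr as (O1 & O2 & O3). unfold lex in *.
    destruct K as [K|[E [K|[E' K]]]], L as [L|[F [L|[F' L]]]];
      rewrite ?E, ?E', <- ?F, <- ?F'; eauto 6 using ordinal_trans.
  - intros p q Hp Hq. rewrite !in_goedel_order.
    destruct (O p Hp) as (P1 & P2 & P3), (O q Hq) as (Q1 & Q2 & Q3). unfold lex.
    destruct (ordinal_trichotomy (pmax p) (pmax q)) as [C|[C|C]]; auto 12.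
    destruct (ordinal_trichotomy (pr1 p) (pr1 q)) as [C'|[C'|C']]; auto 12.
    destruct (ordinal_trichotomy (pr2 p) (pr2 q)) as [E|[E|E]]; auto 12.
    right. left. apply in_prod in Hp as (a & b & _ & _ & ->), Hq as (a' & b' & _ & _ & ->).
    rewrite !pr1_opair in C'. rewrite !pr2_opair in E. now subst.
  - intros s Hs Ns.
    destruct (minimal_value s pmax) as (p1 & H1 & K1); [dfn | trivial |].
    destruct (minimal_value (sep s (fun z => pmax z = pmax p1)) pr1) as (p2 & H2 & K2).
    { dfn. }
    { exists p1. rewrite in_sep by dfn. auto. }
    rewrite in_sep in H2 by dfn. destruct H2 as [H2 E2].
    destruct (minimal_value (sep s (fun z => pmax z = pmax p1 /\ pr1 z = pr1 p2)) pr2)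
      as (p3 & H3 & K3).
    { dfn. }
    { exists p2. rewrite in_sep by dfn. auto. }
    rewrite in_sep in H3 by dfn. destruct H3 as (H3 & E3 & F3).
    exists p3. split; trivial. intros z Hz. rewrite in_goedel_order. unfold lex.
    rewrite E3, F3. intros (_ & _ & [L|[E [L|[E' L]]]]).
    + now apply (K1 z).
    + apply (K2 z); trivial. rewrite in_sep by dfn. auto.
    + apply (K3 z); trivial. rewrite in_sep by dfn. auto.
Qed.

(** The cardinality of [m] is either infinite, where the induction hypothesis of
    Hessenberg's theorem applies, or finite. *)
Lemma small_square_of_smaller (k m : M) :
  infinite_cardinal k ->
  (forall n, n ∈ k -> infinite_cardinal n -> card_le (prod n n) n) ->
  m ∈ k -> small k (prod m m).
Proof.
  intros Hk IH Hm. assert (Ok : ordinal k) by apply Hk.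
  assert (Om : ordinal m) by now apply (ordinal_mem k).
  destruct (well_orderable_cardinality m) as (n & Hn & E).
  { now apply well_orderable_ordinal. }
  assert (Hnk : n ∈ k).
  { apply (ord_le_lt_trans n m); trivial. apply cardinal_card_le; trivial.
    now apply equinumerous_card_le, equinumerous_sym. }
  apply equinumerous_card_le in E.
  apply (small_mono k _ (prod n n)); [now apply card_le_prod|].
  destruct (classic (infinite_cardinal n)) as [I|I].
  - exists n. auto.
  - apply small_square_finite; trivial. split; [apply Hn|]. intros w Hw.
    destruct (ord_lt_or_le n w) as [C|C]; trivial; [apply Hn | apply Hw |].
    destruct I. now apply (infinite_cardinal_of_limit w).
Qed.

(** Hessenberg's theorem: a proper initial segment of Gödel's order on [k] is
    contained in a square of smaller size, so its order type is below [k]. *)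
Theorem card_le_square (k : M) : infinite_cardinal k -> card_le (prod k k) k.
Proof.
  enough (K : forall k, ordinal k -> infinite_cardinal k -> card_le (prod k k) k)
    by (intro Hk; apply K; trivial; apply Hk).
  clear k.
  apply (ordinal_induction (fun k => infinite_cardinal k -> card_le (prod k k) k)); [dfn|]. intros k Ok IH Hk.
  destruct (well_order_iso _ _ (goedel_well_order k Ok)) as (f & o & F).
  assert (W := goedel_well_order k Ok). assert (F' := F). destruct F' as (Oo & Mf & Sf & Of).
  assert (Ho : ord_le o k).
  { destruct (ord_lt_or_le k o) as [C|C]; trivial. exfalso.
    destruct (Sf k C) as (p & Hp & Ep).
    assert (G := ord_iso_seg f _ _ o p (proj1 W) F Hp). rewrite Ep in G.
    apply (cardinal_not_small k k); [apply Hk | apply card_le_refl |].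
    apply (small_onto k (seg (prod k k) (goedel_order k) p) k (app f)); [dfn | trivial | |].
    { intros y Hy. now apply G. }
    assert (Hmax : pmax p ∈ k).
    { apply in_prod in Hp as (a & b & Ha & Hb & ->). unfold pmax. rewrite pr1_opair, pr2_opair.
      apply cup_mem; trivial; now apply (ordinal_mem k). }
    apply (small_subset k _ (prod (succ (pmax p)) (succ (pmax p)))).
    - intros q Hq. apply in_seg in Hq as [Hq K]. apply in_goedel_order in K as (_ & _ & K).
      assert (L : ord_le (pmax q) (pmax p)).
      { destruct K as [K|[K _]]; [now left | now right]. }
      assert (Op : ordinal (pmax p)) by now apply (ordinal_mem k).
      apply in_prod in Hq as (a & b & Ha & Hb & ->). unfold pmax in L.
      rewrite pr1_opair, pr2_opair in L.
      apply (ordinal_mem k) in Ha, Hb; trivial.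
      apply in_prod_opair. rewrite <- !ord_le_succ.
      split; apply (ord_le_trans _ (cup a b)); auto using ord_le_cup_l, ord_le_cup_r.
    - apply small_square_of_smaller; trivial. now apply Hk. }
  apply (card_le_trans _ o); [|now apply ord_le_card_le].
  apply (card_le_of _ _ (app f)); [dfn | exact Mf |].
  intros p q Hp Hq E. destruct (proj1 (proj2 W) p q Hp Hq) as [K|[K|K]]; trivial;
    apply Of in K; trivial; rewrite E in K; destruct (mem_irrefl _ K).
Qed.

Lemma small_prod (k A B : M) :
  infinite_cardinal k -> small k A -> small k B -> small k (prod A B).
Proof.
  intros Hk (a & Ha & HA) (b & Hb & HB). assert (Ok : ordinal k) by apply Hk.
  assert (Oa : ordinal a) by now apply (ordinal_mem k).
  assert (Ob : ordinal b) by now apply (ordinal_mem k).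
  apply (small_mono k _ (prod a b)); [now apply card_le_prod|].
  apply (small_subset k _ (prod (cup a b) (cup a b))).
  - intros p Hp. apply in_prod in Hp as (x & y & Hx & Hy & ->).
    rewrite in_prod_opair, !in_cup. tauto.
  - apply small_square_of_smaller; trivial.
    + intros. now apply card_le_square.
    + now apply cup_mem.
Qed.

Lemma prod_equinumerous_cup (k l : M) :
  cardinal k -> cardinal l -> nonempty k -> infinite_cardinal l ->
  infinite_cardinal (cup k l) /\ equinumerous (prod k l) (cup k l).
Proof.
  intros Hk Hl [x Hx] Il. assert (Ok := proj1 Hk). assert (Ol := proj1 Hl).
  assert (Om : ordinal (cup k l)) by now apply ordinal_cup.
  assert (E : cup k l = k \/ cup k l = l).
  { assert (K : cup k l ∈ cup (upair k k) (upair l l) -> cup k l = k \/ cup k l = l).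
    { rewrite in_cup, !in_upair. tauto. }
    apply K, cup_mem; trivial; rewrite in_cup, !in_upair; tauto. }
  assert (Cm : cardinal (cup k l)) by (destruct E as [-> | ->]; trivial).
  assert (Im : infinite_cardinal (cup k l)).
  { apply (infinite_cardinal_of_limit l); trivial; [apply Il | now apply ord_le_cup_r]. }
  split; trivial. apply cardinal_eq_of_card_le; trivial.
  - apply (card_le_trans _ (prod (cup k l) (cup k l))); [|now apply card_le_square].
    apply card_le_subset. intros p Hp. apply in_prod in Hp as (a & b & Ha & Hb & ->).
    rewrite in_prod_opair, !in_cup. tauto.
  - destruct (proj1 (proj2 (proj2 Il))) as [y Hy]. destruct E as [-> | ->].
    + apply (card_le_of _ _ (fun a => opair a y)); [dfn|..].
      * intros a Ha. now apply in_prod_opair.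
      * intros a b _ _ E. now apply opair_inj in E.
    + apply (card_le_of _ _ (fun a => opair x a)); [dfn|..].
      * intros a Ha. now apply in_prod_opair.
      * intros a b _ _ E. now apply opair_inj in E.
Qed.

End Products.

(** * Surjections from a product with an ordinal *)

Section Lindenbaum_product.
Context {M : set_structure} {HM : ZF M}.
Context (X lam th H : M).
Context (Hth : infinite_cardinal th) (Hlam : lam ∈ th).
Context (H_maps : maps_to (app H) (prod X lam) th).
Context (H_onto : onto (app H) (prod X lam) th).
Context (no_star : ~ card_le_star th X).

Let Oth : ordinal th := proj1 (proj1 Hth).

Lemma no_onto (F : M -> M) :
  DefTerm (fun c : unit * M => F (snd c)) -> ~ onto F X th.
Proof.
  intros HF HS. apply no_star. destruct (proj1 (proj2 (proj2 Hth))) as [b Hb].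
  now apply (card_le_star_of_partial X th b F).
Qed.

(** The surjection [H] as a family of functions on [X] indexed by [lam]. *)
Definition val (b x : M) : M := app H (opair x b).
Definition im (b Z : M) : M := image Z (val b).
Definition vals (Z : M) : M := image (prod Z lam) (app H).

Lemma in_im (b Z y : M) : y ∈ im b Z <-> exists x, x ∈ Z /\ y = val b x.
Proof. unfold im. now rewrite in_image by dfn. Qed.

Lemma in_vals (Z y : M) : y ∈ vals Z <-> exists x b, x ∈ Z /\ b ∈ lam /\ y = val b x.
Proof.
  unfold vals. rewrite in_image by dfn. split.
  - intros (p & Hp & ->). apply in_prod in Hp as (x & b & Hx & Hb & ->). now exists x, b.
  - intros (x & b & Hx & Hb & ->). exists (opair x b). now rewrite in_prod_opair.
Qed.

Lemma vals_subset (Z : M) : subset Z X -> subset (vals Z) th.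
Proof.
  intros HZ y Hy. apply in_vals in Hy as (x & b & Hx & Hb & ->).
  apply H_maps, in_prod_opair. auto.
Qed.

Lemma im_subset_vals (b Z : M) : b ∈ lam -> subset (im b Z) (vals Z).
Proof. intros Hb y Hy. apply in_im in Hy as (x & Hx & ->). apply in_vals. eauto. Qed.

Lemma im_subset (b Z : M) : b ∈ lam -> subset Z X -> subset (im b Z) th.
Proof. intros Hb HZ y Hy. apply (vals_subset Z HZ). now apply (im_subset_vals b Z). Qed.

Lemma ords_th (S : M) : subset S th -> ords S.
Proof. intro K. apply (ords_subset S th); trivial. now apply ords_ordinal. Qed.

(** Otherwise the collapse of the values would map [X] onto [th]. *)
Lemma otp_im (b Z : M) : b ∈ lam -> subset Z X -> otp (im b Z) ∈ th.
Proof.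
  intros Hb HZ. assert (Hs := im_subset b Z Hb HZ). assert (O := ords_th _ Hs).
  destruct (otp_le _ _ Oth Hs) as [C|C]; trivial. exfalso.
  apply (no_onto (fun x => idx (im b Z) (val b x))); [dfn|].
  intros i Hi. rewrite <- C in Hi. destruct (idx_onto _ _ O Hi) as (y & Hy & <-).
  apply in_im in Hy as (x & Hx & ->). eauto.
Qed.

(** A uniform bound on the order types is needed, since [th] may be singular; given one,
    the union is an image of a product. *)
Lemma small_union (T xi : M) (G : M -> M) :
  DefTerm (fun c : unit * M => G (snd c)) ->
  small th T -> xi ∈ th ->
  (forall t, t ∈ T -> subset (G t) th) ->
  (forall t, t ∈ T -> ord_le (otp (G t)) xi) ->
  small th (union (image T G)).
Proof.
  intros HG HT Hxi Hs Hb.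
  apply (small_onto th (prod T xi) _
    (fun p => iota (fun z => z ∈ G (pr1 p) /\ idx (G (pr1 p)) z = pr2 p)));
    [dfn | exact Oth | | now apply small_prod; [| |apply small_mem]].
  intros z Hz. apply in_union in Hz as (y & Hy & Hz). rewrite in_image in Hy by dfn.
  destruct Hy as (t & Ht & ->). assert (O := ords_th _ (Hs t Ht)).
  exists (opair t (idx (G t) z)). rewrite in_prod_opair, pr1_opair, pr2_opair.
  split; [split; trivial|].
  - apply (ord_lt_le_trans _ (otp (G t))); auto using idx_mem. now apply (ordinal_mem th).
  - apply iota_unique; [auto|]. intros w [Hw E]. now apply (idx_inj (G t)).
Qed.

Definition piece (p : M -> M) (Z j : M) : M := sep Z (fun x => p x = j).

Lemma in_piece (p : M -> M) (Z j x : M) :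
  DefTerm (fun c : unit * M => p (snd c)) ->
  (x ∈ piece p Z j <-> x ∈ Z /\ p x = j).
Proof. intro Hp. unfold piece. now rewrite in_sep by dfn. Qed.

Lemma piece_subset (p : M -> M) (Z j : M) :
  DefTerm (fun c : unit * M => p (snd c)) -> subset Z X -> subset (piece p Z j) X.
Proof. intros Hp HZ x Hx. apply in_piece in Hx as []; auto. Qed.

(** On disjoint pieces of [X], one coordinate [b j] for each piece [j] can be used
    at once: collapsing the values taken there maps [X] onto the supremum of the
    order types. *)
Lemma no_selection (p b : M -> M) (Z : M) :
  DefTerm (fun c : unit * M => p (snd c)) ->
  DefTerm (fun c : unit * M => b (snd c)) ->
  subset Z X ->
  ~ (forall xi, xi ∈ th -> exists j, b j ∈ lam /\ xi ∈ otp (im (b j) (piece p Z j))).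
Proof.
  intros Hp Hb HZ K.
  apply (no_onto (fun x => idx (im (b (p x)) (piece p Z (p x))) (val (b (p x)) x))); [dfn|].
  intros xi Hxi. destruct (K xi Hxi) as (j & Hj & L).
  assert (O := ords_th _ (im_subset (b j) _ Hj (piece_subset p Z j Hp HZ))).
  destruct (idx_onto _ _ O L) as (y & Hy & E). apply in_im in Hy as (x & Hx & ->).
  apply in_piece in Hx; trivial. destruct Hx as [Hx Ep]. exists x. rewrite Ep. auto.
Qed.

Definition negligible (Z : M) : Prop := small th (vals Z).

Lemma negligible_subset (Z Z' : M) : subset Z Z' -> negligible Z' -> negligible Z.
Proof.
  intro K. apply small_subset. intros y Hy. apply in_vals in Hy as (x & b & Hx & Hb & ->).
  apply in_vals. eauto 6.
Qed.

(** With all order types bounded by [xi], [small_union] would apply to the [lam] many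
    sets of values. *)
Lemma not_negligible (Z xi : M) :
  subset Z X -> ~ negligible Z -> xi ∈ th -> exists b, b ∈ lam /\ xi ∈ otp (im b Z).
Proof.
  intros HZ N Hxi. apply NNPP. intro K. apply N.
  apply (small_subset th _ (union (image lam (fun b => im b Z)))).
  - intros y Hy. apply in_vals in Hy as (x & b & Hx & Hb & ->).
    apply in_union. exists (im b Z). rewrite in_image by dfn. rewrite in_im. split; eauto.
  - apply (small_union lam xi); [dfn | now apply small_mem | trivial | |].
    + intros b Hb. now apply im_subset.
    + intros b Hb. assert (O := otp_ordinal _ (ords_th _ (im_subset b Z Hb HZ))).
      destruct (ord_lt_or_le xi (otp (im b Z))) as [C|C]; trivial.
      * now apply (ordinal_mem th).
      * destruct K. eauto.
Qed.

(** Negligible sets form an ideal closed under well-ordered unions of length less than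
    [th].  If the union were not negligible, the suprema [sig j] of the order types
    would be cofinal in [th]; the pieces where they exceed all earlier ones, with
    coordinates witnessing this, contradict [no_selection]. *)
Lemma negligible_of_pieces (p : M -> M) (Z : M) :
  DefTerm (fun c : unit * M => p (snd c)) ->
  subset Z X -> (forall x, x ∈ Z -> ordinal (p x)) ->
  small th (image Z p) -> (forall x, x ∈ Z -> negligible (piece p Z (p x))) ->
  negligible Z.
Proof.
  intros Dp HZ Op HT HN. apply NNPP. intro N.
  set (T := image Z p) in *.
  assert (OT : ords T).
  { intros j Hj. unfold T in Hj. rewrite in_image in Hj by dfn.
    destruct Hj as (x & Hx & ->). auto. }
  set (sig := fun j => union (image lam (fun b => otp (im b (piece p Z j))))).
  assert (Dsig : DefTerm (fun c : unit * M => sig (snd c))) by (unfold sig; dfn).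
  assert (HP : forall j, subset (piece p Z j) X) by (intro j; now apply piece_subset).
  assert (Osig' : forall j y, y ∈ image lam (fun b => otp (im b (piece p Z j))) -> ordinal y).
  { intros j y Hy. rewrite in_image in Hy by dfn. destruct Hy as (b & Hb & ->).
    now apply otp_ordinal, ords_th, im_subset. }
  assert (Osig : forall j, ordinal (sig j)) by (intro j; apply ordinal_union, Osig').
  assert (Hsig : forall j, j ∈ T -> sig j ∈ th).
  { intros j Hj. unfold T in Hj. rewrite in_image in Hj by dfn. destruct Hj as (x & Hx & ->).
    apply HN in Hx. assert (Hv := vals_subset _ (HP (p x))).
    apply small_otp in Hx; [|apply Hth | trivial].
    apply (ord_le_lt_trans _ (otp (vals (piece p Z (p x))))); trivial.
    apply union_ord_le; [apply Osig' | now apply (ordinal_mem th) |].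
    intros y Hy. rewrite in_image in Hy by dfn. destruct Hy as (b & Hb & ->).
    apply otp_mono; [now apply ords_th | now apply im_subset_vals]. }
  assert (Hcof : forall xi, xi ∈ th -> exists j, j ∈ T /\ xi ∈ sig j).
  { intros xi Hxi. apply NNPP. intro K. apply N.
    apply (small_subset th _
      (union (image (prod T lam) (fun t => im (pr2 t) (piece p Z (pr1 t)))))).
    - intros y Hy. apply in_vals in Hy as (x & b & Hx & Hb & ->).
      apply in_union. exists (im b (piece p Z (p x))). split.
      + rewrite in_image by dfn. exists (opair (p x) b).
        rewrite in_prod_opair, pr1_opair, pr2_opair. repeat split; trivial.
        unfold T. rewrite in_image by dfn. eauto.
      + apply in_im. exists x. rewrite in_piece by dfn. auto.
    - apply (small_union (prod T lam) xi); trivial; [dfn | | |].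
      + apply small_prod; trivial. now apply small_mem.
      + intros t Ht. apply in_prod in Ht as (j & b & Hj & Hb & ->).
        rewrite pr1_opair, pr2_opair. now apply im_subset.
      + intros t Ht. apply in_prod in Ht as (j & b & Hj & Hb & ->).
        rewrite pr1_opair, pr2_opair.
        apply (ord_le_trans _ (sig j)); [now apply (ordinal_mem th)| |].
        * apply ord_le_union; [apply Osig'|]. rewrite in_image by dfn. eauto.
        * destruct (ord_lt_or_le xi (sig j)) as [C|C]; trivial.
          { now apply (ordinal_mem th). }
          destruct K. eauto. }
  set (tau := fun j => union (image (below T j) sig)).
  assert (Otau' : forall j y, y ∈ image (below T j) sig -> ordinal y).
  { intros j y Hy. rewrite in_image in Hy by dfn. destruct Hy as (i & Hi & ->). apply Osig. }
  set (b := fun j => least (fun b => b ∈ lam /\ tau j ∈ otp (im b (piece p Z j)))).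
  assert (Olam : ordinal lam) by now apply (ordinal_mem th).
  apply (no_selection p b Z); trivial; [unfold b, tau; dfn|].
  intros xi Hxi.
  destruct (ordinal_least (fun j => j ∈ T /\ xi ∈ sig j)) as (j0 & O0 & [H0 K0] & L0).
  { dfn. }
  { destruct (Hcof xi Hxi) as (j & Hj & K). exists j. auto. }
  destruct (ordinal_least (fun j => j ∈ T /\ sig j0 ∈ sig j)) as (j1 & O1 & [H1 K1] & L1).
  { dfn. }
  { destruct (Hcof (sig j0)) as (j & Hj & K); auto. exists j. auto. }
  assert (Hlt : j0 ∈ j1).
  { destruct (ord_lt_or_le j0 j1) as [C|C]; trivial. exfalso.
    destruct C as [C|C]; [|subst; now apply (mem_irrefl (sig j0))].
    apply (ord_le_not_lt j0 j1); [apply L0 | exact C]; [exact O1|].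
    split; [exact H1|]. exact (ordinal_trans _ (sig j0) _ (Osig j1) K1 K0). }
  assert (T0 : ord_le (sig j0) (tau j1)).
  { apply ord_le_union; [apply Otau'|]. rewrite in_image by dfn. exists j0.
    rewrite in_below. auto. }
  assert (T1 : tau j1 ∈ sig j1).
  { apply (ord_le_lt_trans _ (sig j0)); auto. apply union_ord_le; auto.
    { apply Otau'. }
    intros y Hy. rewrite in_image in Hy by dfn. destruct Hy as (j & Hj & ->).
    apply in_below in Hj as [Hj Hj1]. destruct (ord_lt_or_le (sig j0) (sig j)) as [C|C]; auto.
    destruct (ord_le_not_lt j1 j); trivial. apply L1; auto. }
  destruct (least_spec (fun b => b ∈ lam /\ tau j1 ∈ otp (im b (piece p Z j1))))
    as (_ & [Hb Kb] & _).
  { unfold tau. dfn. }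
  { apply in_union in T1 as (y & Hy & K). rewrite in_image in Hy by dfn.
    destruct Hy as (b' & Hb' & ->). exists b'. split; [now apply (ordinal_mem lam) | auto]. }
  exists j1. split; [exact Hb|].
  assert (Oim := otp_ordinal _ (ords_th _ (im_subset _ _ Hb (HP j1)))).
  apply (ordinal_trans _ (tau j1)); trivial.
  apply (ord_lt_le_trans _ (sig j0)); trivial. now apply (ordinal_mem _ _ Oim).
Qed.

Definition fiber (b y : M) : M := sep X (fun x => val b x = y).

Definition big_values (b : M) : M := sep (im b X) (fun y => ~ negligible (fiber b y)).

Lemma in_big_values (b y : M) :
  y ∈ big_values b <-> y ∈ im b X /\ ~ negligible (fiber b y).
Proof. unfold big_values. rewrite in_sep by (unfold fiber; dfn). reflexivity. Qed.

Lemma big_values_subset (b : M) : b ∈ lam -> subset (big_values b) th.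
Proof.
  intros Hb y Hy. apply in_big_values in Hy as [Hy _]. revert y Hy.
  apply (im_subset b X Hb). now intro.
Qed.

Definition small_part : M := sep X (fun x => exists b, b ∈ lam /\ ~ val b x ∈ big_values b).

(** For one coordinate, the negligible fibers are as many as its values, hence fewer than
    [th]; the coordinates are [lam] many. *)
Lemma negligible_small_part : negligible small_part.
Proof.
  assert (Olam : ordinal lam) by now apply (ordinal_mem th).
  set (E := fun b => sep X (fun x => ~ val b x ∈ big_values b)).
  assert (HE : forall b x, x ∈ E b <-> x ∈ X /\ ~ val b x ∈ big_values b).
  { intros b x. unfold E. now rewrite in_sep by dfn. }
  assert (NE : forall b, b ∈ lam -> negligible (E b)).
  { intros b Hb. assert (SE : subset (E b) X) by (intros x Hx; now apply HE in Hx).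
    apply (negligible_of_pieces (val b)); trivial; [dfn | | |].
    - intros x Hx. apply (ords_th _ (im_subset b X Hb (fun z Hz => Hz))). apply in_im.
      apply HE in Hx as []. eauto.
    - apply (small_otp th (im b (E b))); [apply Hth | now apply im_subset | now apply otp_im].
    - intros x Hx. apply NNPP. intro N. apply HE in Hx as [Hx Nx]. apply Nx, in_big_values.
      split; [apply in_im; eauto|]. intro K. apply N. revert K. apply negligible_subset.
      intros z Hz. apply in_piece in Hz as [Hz Ez]; [|dfn]. apply HE in Hz as [Hz _].
      unfold fiber. rewrite in_sep by dfn. auto. }
  set (p := fun x => least (fun b => b ∈ lam /\ ~ val b x ∈ big_values b)).
  assert (Dp : DefTerm (fun c : unit * M => p (snd c))) by (unfold p; dfn).
  assert (Hs : forall x, x ∈ small_part <->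
    x ∈ X /\ exists b, b ∈ lam /\ ~ val b x ∈ big_values b).
  { intro x. unfold small_part. now rewrite in_sep by dfn. }
  assert (Hp : forall x, x ∈ small_part -> p x ∈ lam /\ ~ val (p x) x ∈ big_values (p x)).
  { intros x Hx. apply Hs in Hx as (Hx & b & Hb & Nb).
    refine (proj1 (proj2 (least_spec (fun b => b ∈ lam /\ ~ val b x ∈ big_values b) _ _))).
    exists b. split; [now apply (ordinal_mem lam) | auto]. }
  apply (negligible_of_pieces p); trivial.
  - intros x Hx. now apply Hs in Hx.
  - intros x Hx. apply (ordinal_mem lam); trivial. now apply Hp.
  - apply (small_subset th _ lam); [|now apply small_mem]. intros y Hy.
    rewrite in_image in Hy by dfn. destruct Hy as (x & Hx & ->). now apply Hp.
  - intros x Hx. apply (negligible_subset _ (E (p x))); [|now apply NE, Hp].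
    intros z Hz. apply in_piece in Hz as [Hz Ez]; trivial. apply HE.
    rewrite <- Ez. split; [now apply Hs in Hz | now apply Hp].
Qed.

(** Otherwise [lam] many pieces that are not negligible could be found among the
    fibers of one coordinate, and prescribing cofinal order types on them would
    contradict [no_selection]. *)
Lemma big_values_bounded :
  exists xi, xi ∈ th /\ forall b, b ∈ lam -> ord_le (otp (big_values b)) xi.
Proof.
  assert (Olam : ordinal lam) by now apply (ordinal_mem th).
  assert (OG : forall b, b ∈ lam -> ordinal (otp (big_values b))).
  { intros b Hb. now apply otp_ordinal, ords_th, big_values_subset. }
  apply NNPP. intro N.
  assert (Hcof : forall xi, xi ∈ th -> exists b, b ∈ lam /\ xi ∈ otp (big_values b)).
  { intros xi Hxi. apply NNPP. intro K. apply N. exists xi. split; trivial. intros b Hb.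
    destruct (ord_lt_or_le xi (otp (big_values b))) as [C|C]; trivial; auto.
    - now apply (ordinal_mem th).
    - destruct K. eauto. }
  destruct (Hcof lam Hlam) as (b0 & Hb0 & K0).
  set (p := fun x => idx (big_values b0) (val b0 x)).
  assert (Dp : DefTerm (fun c : unit * M => p (snd c))) by (unfold p; dfn).
  set (b := fun j => least (fun b => b ∈ lam /\
    otp (big_values j) ∈ otp (im b (piece p X j)))).
  apply (no_selection p b X); trivial; [unfold b; dfn | now intro |].
  intros xi Hxi. destruct (Hcof xi Hxi) as (j & Hj & Kj). exists j.
  assert (SP : subset (piece p X j) X) by (apply piece_subset; trivial; now intro).
  destruct (least_spec (fun b => b ∈ lam /\ otp (big_values j) ∈ otp (im b (piece p X j))))
    as (_ & [Hb Kb] & _).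
  - dfn.
  - destruct (not_negligible (piece p X j) (otp (big_values j))) as (b' & Hb' & K'); trivial.
    + destruct (idx_onto (big_values b0) j) as (y & Hy & Ey).
      { now apply ords_th, big_values_subset. }
      { apply (ordinal_trans _ lam); auto. }
      apply in_big_values in Hy as [_ Ny]. intro K. apply Ny. revert K.
      apply negligible_subset. intros x Hx. unfold fiber in Hx. rewrite in_sep in Hx by dfn.
      destruct Hx as [Hx Ex]. apply in_piece; trivial. split; trivial.
      unfold p. now rewrite Ex.
    + apply (ord_le_lt_trans _ (otp (im j X))); trivial.
      * apply otp_mono.
        { apply ords_th, im_subset; trivial. now intro. }
        intros y Hy. now apply in_big_values in Hy as [].
      * apply otp_im; trivial. now intro.
    + exists b'. split; [now apply (ordinal_mem lam) | auto].
  - split; trivial. apply (ordinal_trans _ (otp (big_values j))); trivial.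
    apply otp_ordinal, ords_th, im_subset; trivial.
Qed.

(** Outside [small_part] all values of the coordinate [b] lie in [big_values b], and
    there are too few of these. *)
Lemma no_surjection_from_product : False.
Proof.
  set (R := sep X (fun x => ~ x ∈ small_part)).
  assert (HR : forall x, x ∈ R <-> x ∈ X /\ ~ x ∈ small_part).
  { intro x. unfold R. now rewrite in_sep by dfn. }
  assert (NR : negligible R).
  { destruct big_values_bounded as (xi & Hxi & Bxi).
    apply (small_subset th _ (union (image lam big_values))).
    - intros y Hy. apply in_vals in Hy as (x & b & Hx & Hb & ->). apply in_union.
      exists (big_values b). rewrite in_image by dfn. split; [eauto|].
      apply NNPP. intro N. apply HR in Hx as [Hx Nx]. apply Nx.
      unfold small_part. rewrite in_sep by dfn. eauto.
    - apply (small_union lam xi); trivial; [dfn | now apply small_mem |].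
      intros b Hb. now apply big_values_subset. }
  apply (cardinal_not_small th th); [apply Hth | apply card_le_refl |].
  (* [X] is cut into [small_part] and its complement, indexed by 0 and 1. *)
  set (p := fun x => ite (x ∈ small_part) emptyset (succ emptyset)).
  assert (Dp : DefTerm (fun c : unit * M => p (snd c))) by (unfold p; dfn).
  assert (H0 : emptyset ∈ th) by (apply empty_in_ordinal; trivial; apply Hth).
  assert (H1 : succ emptyset ∈ th) by now apply Hth.
  assert (H2 : succ (succ emptyset) ∈ th) by now apply Hth.
  assert (Hp : forall x, p x ∈ succ (succ emptyset)).
  { intro x. unfold p. destruct (classic (x ∈ small_part)) as [K|K].
    - rewrite ite_true; trivial. rewrite !in_succ. tauto.
    - rewrite ite_false; trivial. rewrite !in_succ. tauto. }
  apply (small_subset th _ (vals X)).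
  { intros y Hy. destruct (H_onto y Hy) as (q & Hq & <-).
    apply in_prod in Hq as (x & b & Hx & Hb & ->). apply in_vals. now exists x, b. }
  apply (negligible_of_pieces p); trivial.
  - now intro.
  - intros x _. apply (ordinal_mem (succ (succ emptyset))); trivial.
    auto using ordinal_succ, ordinal_empty.
  - apply (small_subset th _ (succ (succ emptyset))); [|now apply small_mem].
    intros y Hy. rewrite in_image in Hy by dfn. destruct Hy as (x & _ & ->). apply Hp.
  - intros x Hx. destruct (classic (x ∈ small_part)) as [K|K].
    + apply (negligible_subset _ small_part); [|apply negligible_small_part].
      intros z Hz. apply in_piece in Hz as [Hz Ez]; trivial. apply NNPP. intro Nz.
      unfold p in Ez. rewrite ite_false, ite_true in Ez; trivial.
      apply (not_in_empty emptyset). rewrite <- Ez at 2. apply in_succ. tauto.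
    + apply (negligible_subset _ R); trivial.
      intros z Hz. apply in_piece in Hz as [Hz Ez]; trivial. apply HR. split; trivial. intro Kz.
      unfold p in Ez. rewrite ite_true, ite_false in Ez; trivial.
      apply (not_in_empty emptyset). rewrite Ez at 2. apply in_succ. tauto.
Qed.

End Lindenbaum_product.

(** Counting values coordinate by coordinate proves this for regular [th] only; the ideal
    of negligible sets takes the place of regularity. *)
Theorem card_le_star_prod {M : set_structure} {HM : ZF M} (X lam th : M) :
  infinite_cardinal th -> lam ∈ th -> card_le_star th (prod X lam) -> card_le_star th X.
Proof.
  intros Hth Hlam [[H HH]|E].
  - apply surjection_app in HH as [H1 H2]. apply NNPP. intro N.
    exact (no_surjection_from_product X lam th H Hth Hlam H1 H2 N).
  - destruct (E lam Hlam).
Qed.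

(** * The set of pairs below a cofinal function *)

Section Main.
Context {M : set_structure} {HM : ZF M}.

Lemma ex_card_succ (k : M) :
  cardinal k -> exists h, is_hartogs k h /\ is_card_succ k h.
Proof.
  intro Hk. destruct (ex_hartogs k) as [h Hh]. exists h. split; trivial.
  now apply card_succ_of_hartogs.
Qed.

(** [Y] is the set of pairs [(x, b)] with [b <= F x].  The weak inequality makes the
    first projection onto [Z] even where [F] vanishes. *)
Theorem pairs_below (Z lam lZ : M) (F : M -> M) :
  DefTerm (fun c : unit * M => F (snd c)) ->
  infinite_cardinal lam -> is_lindenbaum Z lZ ->
  maps_to F Z lam ->
  (forall a, a ∈ lam -> exists x, x ∈ Z /\ ord_le a (F x)) ->
  (forall e, maps_to (app e) lam Z ->
     small lam (image lam (app e)) /\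
     exists d, d ∈ lam /\ forall i, i ∈ lam -> ord_le (F (app e i)) d) ->
  exists Y lY lam_plus,
    is_hartogs Y lam /\ is_lindenbaum Y lY /\ is_card_succ lam lam_plus /\
    is_card_prod lZ lam_plus lY.
Proof.
  intros DF Hlam HlZ MF Hunb Hsmall.
  assert (Ol : ordinal lam) by apply Hlam.
  destruct (ex_card_succ lam (proj1 Hlam)) as (lp & Hlp & Slp).
  assert (Clp := hartogs_cardinal _ _ Hlp).
  assert (ClZ := lindenbaum_cardinal _ _ HlZ).
  assert (Llp : lam ∈ lp) by apply Slp.
  assert (Ilp : infinite_cardinal lp).
  { apply (infinite_cardinal_of_limit lam); trivial; [apply Hlam | now left]. }
  set (Y := sep (prod Z lam) (fun p => ord_le (pr2 p) (F (pr1 p)))).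
  assert (HY : forall x b, opair x b ∈ Y <-> x ∈ Z /\ b ∈ lam /\ ord_le b (F x)).
  { intros x b. unfold Y. rewrite in_sep by dfn.
    rewrite in_prod_opair, pr1_opair, pr2_opair. tauto. }
  assert (YE : forall p, p ∈ Y -> exists x b, p = opair x b).
  { intros p Hp. unfold Y in Hp. rewrite in_sep in Hp by dfn. destruct Hp as [Hp _].
    apply in_prod in Hp as (x & b & _ & _ & ->). eauto. }
  assert (N0 : nonempty lZ).
  { exists emptyset. apply (lt_lindenbaum Z lZ); trivial; [apply ordinal_empty|].
    right. exact not_in_empty. }
  assert (OlZ : ordinal lZ) by apply ClZ. assert (Olp : ordinal lp) by apply Clp.
  destruct (prod_equinumerous_cup lZ lp ClZ Clp N0 Ilp) as [Ith Eth].
  set (th := cup lZ lp) in *.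
  assert (Oth : ordinal th) by apply Ith.
  exists Y, th, lp. split; [|split; [|split]]; trivial.
  - split; [|split]; trivial.
    + intro H. apply card_le_app in H as (g & Mg & Ig).
      assert (Dg : DefTerm (fun c : unit * M => pr1 (app g (snd c)))) by dfn.
      set (e := graph lam (fun i => pr1 (app g i))).
      assert (He : forall i, i ∈ lam -> app e i = pr1 (app g i)).
      { intros i Hi. unfold e. apply (app_graph lam (fun i => pr1 (app g i))); trivial. }
      destruct (Hsmall e) as (Hs & d & Hd & Bd).
      { intros i Hi. rewrite He; trivial. assert (K := Mg i Hi).
        destruct (YE _ K) as (x & b & E). rewrite E in K |- *. apply HY in K.
        rewrite pr1_opair. tauto. }
      assert (Od : ordinal (succ d)) by (apply ordinal_succ; now apply (ordinal_mem lam)).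
      apply (cardinal_not_small lam (prod (image lam (app e)) (succ d))); [apply Hlam| |].
      * apply (card_le_of _ _ (app g)); [dfn | | trivial].
        intros i Hi. assert (K := Mg i Hi). assert (L := He i Hi). assert (B := Bd i Hi).
        destruct (YE _ K) as (x & b & E). rewrite E in K, L |- *. rewrite pr1_opair in L.
        apply HY in K as (Hx & Hb & Hbx). apply in_prod_opair. split.
        { rewrite in_image by dfn. eauto. }
        apply ord_le_succ. apply (ord_le_trans _ (F x)); [now apply (ordinal_mem lam) | trivial |].
        now rewrite <- L.
      * apply small_prod; trivial. apply small_mem. now apply Hlam.
    + intros y Oy Ny. destruct (ord_lt_or_le y lam) as [C|C]; trivial. destruct Ny.
      destruct (Hunb y C) as (x & Hx & K).
      apply (card_le_of _ _ (fun b => opair x b)); [dfn|..].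
      * intros b Hb. apply HY. split; [trivial|]. split; [now apply (ordinal_trans lam y)|].
        left. apply (ord_lt_le_trans _ y); trivial. apply (ordinal_mem lam); auto.
      * intros b b' _ _ E. now apply opair_inj in E.
  - split; [|split]; trivial.
    + intro H.
      assert (K : card_le_star th (prod Z lam)).
      { destruct H as [[g Hg]|E].
        - apply surjection_app in Hg as [Mg Sg]. destruct (proj1 (proj2 (proj2 Ith))) as [b Hb].
          apply (card_le_star_of_partial _ _ b (app g)); [dfn | trivial |].
          intros y Hy. destruct (Sg y Hy) as (p & Hp & E). exists p. split; trivial.
          unfold Y in Hp. rewrite in_sep in Hp by dfn. tauto.
        - now right. }
      apply (card_le_star_prod Z lam th) in K; trivial.
      * apply (lt_lindenbaum Z lZ) in K; trivial. apply (ord_le_not_lt lZ th); trivial.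
        now apply ord_le_cup_l.
      * apply in_cup. now right.
    + intros y Oy Ny. destruct (ord_lt_or_le y th) as [C|C]; trivial. destruct Ny.
      apply in_cup in C as [C|C].
      * apply (card_le_star_trans _ Z); [now apply (lt_lindenbaum Z lZ)|].
        apply (card_le_star_of Y Z pr1); [dfn|..].
        -- intros p Hp. destruct (YE p Hp) as (x & b & ->). rewrite pr1_opair.
           now apply HY in Hp.
        -- intros x Hx. exists (opair x emptyset). rewrite pr1_opair, HY.
           assert (H0 : emptyset ∈ lam) by (apply empty_in_ordinal; trivial; apply Hlam).
           repeat split; trivial.
           destruct (ord_lt_or_le (F x) emptyset) as [D|D]; trivial.
           { apply (ordinal_mem lam); auto. }
           { apply ordinal_empty. }
           destruct (not_in_empty _ D).
      * apply (lt_hartogs lam lp) in C; trivial.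
        apply (card_le_star_trans _ lam); [now apply card_le_star_of_card_le|].
        apply (card_le_star_of Y lam pr2); [dfn|..].
        -- intros p Hp. destruct (YE p Hp) as (x & b & ->). rewrite pr2_opair.
           now apply HY in Hp.
        -- intros b Hb. destruct (Hunb b Hb) as (x & Hx & K).
           exists (opair x b). rewrite pr2_opair, HY. auto.
  - split; [apply Ith|]. exists (prod lZ lp). rewrite is_cartesian_iff. auto.
Qed.

(** * Cofinality *)

Lemma cf_cofinal (x c : M) :
  is_cf x c -> exists q, maps_to (app q) c x /\
    forall z, z ∈ x -> exists i, i ∈ c /\ ord_le z (app q i).
Proof.
  intros (_ & (f & Hf & Cf) & _). exists f. split.
  - intros i. now apply function_app.
  - intros z Hz. destruct (Cf z Hz) as (i & y & K & L).
    apply (function_maps f c x i y Hf) in K as [Hi ->]. eauto.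
Qed.

Lemma cf_le_of (x c b : M) (F : M -> M) :
  DefTerm (fun c : unit * M => F (snd c)) ->
  is_cf x c -> ordinal b -> maps_to F b x ->
  (forall z, z ∈ x -> exists i, i ∈ b /\ ord_le z (F i)) -> ord_le c b.
Proof.
  intros HF (_ & _ & L) Ob MF CF. apply L; trivial. exists (graph b F).
  split; [now apply graph_function|]. intros z Hz. destruct (CF z Hz) as (i & Hi & K).
  exists i, (F i). split; trivial. now apply maps_graph.
Qed.

Lemma cf_bounded (x c b : M) (F : M -> M) :
  DefTerm (fun c : unit * M => F (snd c)) ->
  ordinal x -> is_cf x c -> b ∈ c -> maps_to F b x ->
  exists z, z ∈ x /\ forall i, i ∈ b -> F i ∈ z.
Proof.
  intros HF Ox Hc Hb MF. apply NNPP. intro N. apply (ord_le_not_lt c b); trivial.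
  apply (cf_le_of x c b F); trivial.
  - apply (ordinal_mem c); trivial. apply Hc.
  - intros z Hz. apply NNPP. intro K. apply N. exists z. split; trivial.
    intros i Hi. destruct (ord_lt_or_le (F i) z) as [C|C]; trivial.
    + apply (ordinal_mem x); auto.
    + now apply (ordinal_mem x).
    + destruct K. eauto.
Qed.

Lemma cf_le (x c : M) : ordinal x -> is_cf x c -> ord_le c x.
Proof.
  intros Ox Hc. apply (cf_le_of x c x (fun i => i)); trivial; [dfn | now intro |].
  intros z Hz. exists z. auto using ord_le_refl.
Qed.

(** A successor has cofinality at most 1, the only element of the cofinal set being its
    predecessor. *)
Lemma limit_of_cf (x c : M) :
  ordinal x -> is_cf x c -> succ emptyset ∈ c -> limit x.
Proof.
  intros Ox Hc H1. split; [|split]; trivial.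
  - destruct (cf_cofinal x c Hc) as (q & Mq & _). exists (app q (succ emptyset)). auto.
  - intros a Ha. assert (Oa : ordinal a) by now apply (ordinal_mem x).
    destruct (succ_le a x) as [C|C]; trivial. exfalso.
    apply (ord_le_not_lt c (succ emptyset)); trivial.
    apply (cf_le_of x c _ (fun _ => a)); trivial; [dfn | | |].
    + apply ordinal_succ, ordinal_empty.
    + intros i _. trivial.
    + intros z Hz. exists emptyset. rewrite in_succ. split; [now right|].
      rewrite <- C in Hz. now apply ord_le_succ.
Qed.

Lemma one_lt_cf (x c : M) : limit x -> is_cf x c -> succ emptyset ∈ c.
Proof.
  intros (Ox & Nx & Sx) Hc.
  destruct (ord_lt_or_le (succ emptyset) c) as [C|C]; trivial.
  - apply ordinal_succ, ordinal_empty.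
  - apply Hc.
  - exfalso. destruct (cf_cofinal x c Hc) as (q & Mq & Cq).
    assert (K : forall i, i ∈ c -> i = emptyset).
    { intros i Hi. assert (L : i ∈ succ emptyset).
      { apply (ord_lt_le_trans i c); trivial. apply ordinal_succ, ordinal_empty. }
      apply in_succ in L as [L|L]; trivial. destruct (not_in_empty i L). }
    destruct Nx as [y Hy]. destruct (Cq y Hy) as (i & Hi & _).
    destruct (Cq (succ (app q i))) as (j & Hj & L); auto.
    rewrite (K i Hi), (K j Hj) in L. apply (ord_le_not_lt _ _ L). apply in_succ. tauto.
Qed.

(** * Sets that map onto the cofinality *)

(** Since [hX <= cf lam], a well-orderable subset of [X] has fewer than [cf lam] elements,
    so every map from it to [lam] is bounded. *)
Theorem pairs_below_surjection (X lam hX lX c : M) :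
  is_hartogs X hX -> is_lindenbaum X lX -> cardinal lam -> is_cf lam c ->
  ord_le hX c -> c ∈ lX ->
  exists Y lY lam_plus : M,
    is_hartogs Y lam /\ is_lindenbaum Y lY /\ is_card_succ lam lam_plus /\
    is_card_prod lX lam_plus lY.
Proof.
  intros HhX HlX Clam Hc Hle Hlt.
  assert (Ol : ordinal lam) by apply Clam. assert (Oc : ordinal c) by apply Hc.
  assert (H0 : emptyset ∈ c).
  { apply (ord_lt_le_trans _ hX); trivial. apply (lt_hartogs X hX); trivial.
    - apply ordinal_empty.
    - apply card_le_subset. intros z Hz. destruct (not_in_empty z Hz). }
  apply (lt_lindenbaum X lX) in Hlt; trivial. destruct Hlt as [[f Hf]|E]; [|destruct (E _ H0)].
  apply surjection_app in Hf as [Mf Sf].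
  assert (H1 : succ emptyset ∈ c).
  { apply (ord_lt_le_trans _ hX); trivial. apply (lt_hartogs X hX); trivial.
    - apply ordinal_succ, ordinal_empty.
    - destruct (Sf emptyset H0) as (x & Hx & _).
      apply (card_le_of _ _ (fun _ => x)); [dfn|..].
      + intros z _. trivial.
      + intros z z' Hz Hz' _. apply in_succ in Hz as [Hz| ->], Hz' as [Hz'| ->]; trivial;
          match goal with K : _ ∈ emptyset |- _ => destruct (not_in_empty _ K) end. }
  assert (Il : infinite_cardinal lam) by (split; trivial; now apply (limit_of_cf lam c)).
  destruct (cf_cofinal lam c Hc) as (q & Mq & Cq).
  apply (pairs_below X lam lX (fun x => app q (app f x))); trivial.
  - dfn.
  - intros x Hx. auto.
  - intros a Ha. destruct (Cq a Ha) as (i & Hi & K). destruct (Sf i Hi) as (x & Hx & <-). eauto.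
  - intros e Me.
    destruct (well_orderable_cardinality (image lam (app e))) as (a & Ca & Ea).
    { exists lam. split; trivial. apply card_le_image; [dfn|].
      now apply well_orderable_ordinal. }
    assert (Ha : a ∈ c).
    { apply (ord_lt_le_trans _ hX); trivial. apply (lt_hartogs X hX); trivial; [apply Ca|].
      apply (card_le_trans _ (image lam (app e))).
      - now apply equinumerous_card_le, equinumerous_sym.
      - apply card_le_subset. intros x Hx. rewrite in_image in Hx by dfn.
        destruct Hx as (i & Hi & ->). auto. }
    split.
    + exists a. split; [|now apply equinumerous_card_le].
      apply (ord_lt_le_trans _ c); trivial. now apply cf_le.
    + apply equinumerous_sym, equinumerous_app in Ea as (g & Mg & _ & Sg).
      destruct (cf_bounded lam c a (fun i => app q (app f (app g i)))) as (z & Hz & Bz);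
        trivial; [dfn | |].
      * intros i Hi. apply Mq, Mf. assert (K := Mg i Hi). rewrite in_image in K by dfn.
        destruct K as (j & Hj & ->). auto.
      * exists z. split; trivial. intros i Hi. left.
        destruct (Sg (app e i)) as (j & Hj & <-); auto.
        rewrite in_image by dfn. eauto.
Qed.

(** * Sets of injections *)

Definition injections_below (mu X : M) : M :=
  sep (pow (prod mu X)) (fun f => exists a, a ∈ mu /\ is_injection f a X).

Lemma injections_below_spec (mu X : M) :
  ordinal mu -> is_injections_below mu X (injections_below mu X).
Proof.
  intros Omu f. unfold injections_below. rewrite in_sep by dfn. rewrite in_pow.
  split; [tauto|]. intros (a & Ha & Hf). split; [|eauto]. intros p Hp.
  destruct (proj1 (proj1 Hf) p Hp) as (x & y & Hx & Hy & E). apply is_opair_iff in E.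
  subst p. apply in_prod_opair. split; trivial. now apply (ordinal_trans mu a).
Qed.

Lemma in_injections_below (mu X g : M) :
  ordinal mu -> g ∈ injections_below mu X -> dom g ∈ mu /\ is_injection g (dom g) X.
Proof.
  intros Omu Hg. apply injections_below_spec in Hg as (a & Ha & Hf); trivial.
  now rewrite (dom_function g a X (proj1 Hf)).
Qed.

Lemma is_succ_iff (s x : M) : is_succ s x <-> s = succ x.
Proof.
  split.
  - intro H. apply set_ext. intro z. now rewrite in_succ.
  - intros -> z. apply in_succ.
Qed.

Lemma singular_infinite (mu : M) : singular mu -> infinite_cardinal mu.
Proof.
  intros (Cmu & (w & (Ow & (Nw & Sw) & _) & Hw) & _).
  apply (infinite_cardinal_of_limit w); trivial. split; [|split]; trivial.
  intros a Ha. destruct (Sw a Ha) as (s & E & Hs). apply is_succ_iff in E. now subst.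
Qed.

Lemma limit_cardinal_infinite (mu : M) : limit_cardinal mu -> infinite_cardinal mu.
Proof.
  intros (Cmu & Nmu & Smu). assert (Omu : ordinal mu) by apply Cmu.
  split; trivial. split; [|split]; trivial. intros a Ha.
  assert (Oa : ordinal a) by now apply (ordinal_mem mu).
  destruct (succ_le a mu) as [C|C]; trivial. exfalso.
  destruct (well_orderable_cardinality a (well_orderable_ordinal a Oa)) as (k & Ck & Ek).
  assert (Hk : k ∈ mu).
  { apply (ord_le_lt_trans _ a); trivial. apply cardinal_card_le; trivial.
    now apply equinumerous_card_le, equinumerous_sym. }
  destruct (Smu k Hk Ck) as (y & (Oy & (Cy & Hky) & _) & Hy).
  rewrite <- C in Hy. apply ord_le_succ in Hy.
  apply (cardinal_not_card_le y k Cy Hky). apply (card_le_trans _ a).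
  - now apply ord_le_card_le.
  - now apply equinumerous_card_le.
Qed.

Section Families.
Context (X mu lam e : M).
Context (HX : is_hartogs X mu) (Imu : infinite_cardinal mu) (Ilam : infinite_cardinal lam).
Context (He : maps_to (app e) lam (injections_below mu X)).

Let Omu : ordinal mu := proj1 (proj1 Imu).
Let Olam : ordinal lam := proj1 (proj1 Ilam).

Lemma family_dom (i : M) : i ∈ lam -> dom (app e i) ∈ mu.
Proof. intro Hi. now apply (in_injections_below mu X), He. Qed.

Lemma family_app (i : M) :
  i ∈ lam -> maps_to (app (app e i)) (dom (app e i)) X /\ inj_on (app (app e i)) (dom (app e i)).
Proof. intro Hi. now apply injection_app, (in_injections_below mu X), He. Qed.

Definition range : M :=
  sep X (fun x => exists i z, i ∈ lam /\ z ∈ dom (app e i) /\ x = app (app e i) z).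

Lemma in_range (i z : M) : i ∈ lam -> z ∈ dom (app e i) -> app (app e i) z ∈ range.
Proof.
  intros Hi Hz. unfold range. rewrite in_sep by dfn. split; [|eauto].
  now apply (family_app i Hi).
Qed.

(** The union of the ranges is an image of [lam] times [mu], and it injects into [X]. *)
Lemma range_cardinality : exists w, w ∈ mu /\ cardinal w /\ equinumerous range w.
Proof.
  destruct (prod_equinumerous_cup lam mu) as [Ith Eth];
    [apply Ilam | apply Imu | apply Ilam | trivial |].
  assert (W : well_orderable (prod lam mu)).
  { exists (cup lam mu). split; [apply Ith | now apply equinumerous_card_le]. }
  destruct (well_orderable_cardinality range) as (w & Cw & Ew).
  - destruct W as (a & Oa & Ka). exists a. split; trivial.
    apply (card_le_trans _ (prod lam mu)); trivial.
    apply (card_le_trans _ (image (prod lam mu) (fun p => app (app e (pr1 p)) (pr2 p)))).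
    + apply card_le_subset. intros x Hx. unfold range in Hx. rewrite in_sep in Hx by dfn.
      destruct Hx as (_ & i & z & Hi & Hz & ->). rewrite in_image by dfn.
      exists (opair i z). rewrite in_prod_opair, pr1_opair, pr2_opair.
      repeat split; trivial. apply (ordinal_trans mu (dom (app e i))); trivial.
      now apply family_dom.
    + apply card_le_image; [dfn|]. exists a. auto.
  - exists w. split; [|split]; trivial. apply (lt_hartogs X mu); trivial; [apply Cw|].
    apply (card_le_trans _ range).
    + now apply equinumerous_card_le, equinumerous_sym.
    + apply card_le_subset. intros x Hx. unfold range in Hx. rewrite in_sep in Hx by dfn. tauto.
Qed.

(** Suppose that the domains are unbounded in [mu], and let [w < mu] be the size of the
    union of the ranges.  If [mu] is a limit cardinal, some domain contains [w+], which
    would inject into [w].  If [mu] is singular, cofinally many of the injections,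
    indexed by [cf mu < mu], invert to a map of [cf mu * w] onto [mu]. *)
Lemma family_dom_bounded :
  singular mu \/ limit_cardinal mu ->
  exists a, a ∈ mu /\ forall i, i ∈ lam -> ord_le (dom (app e i)) a.
Proof.
  intro Hmu. destruct range_cardinality as (w & Hw & Cw & Ew).
  apply equinumerous_card_le in Ew.
  apply NNPP. intro N.
  assert (Hcof : forall a, a ∈ mu -> exists i, i ∈ lam /\ a ∈ dom (app e i)).
  { intros a Ha. apply NNPP. intro K. apply N. exists a. split; trivial. intros i Hi.
    destruct (ord_lt_or_le a (dom (app e i))) as [C|C]; trivial.
    - now apply (ordinal_mem mu).
    - apply (ordinal_mem mu); trivial. now apply family_dom.
    - destruct K. eauto. }
  destruct Hmu as [(_ & _ & c & Hc & Hcmu)|(_ & _ & Smu)].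
  - destruct (cf_cofinal mu c Hc) as (q & Mq & Cq).
    set (k := fun i => least (fun k => k ∈ lam /\ app q i ∈ dom (app e k))).
    assert (Dk : DefTerm (fun c : unit * M => k (snd c))) by (unfold k; dfn).
    assert (Hk : forall i, i ∈ c -> k i ∈ lam /\ app q i ∈ dom (app e (k i))).
    { intros i Hi.
      refine (proj1 (proj2 (least_spec (fun k => k ∈ lam /\ app q i ∈ dom (app e k)) _ _))).
      destruct (Hcof (app q i)) as (j & Hj & K); auto. exists j.
      split; [now apply (ordinal_mem lam) | auto]. }
    apply (cardinal_not_small mu mu); [apply Imu | apply card_le_refl |].
    apply (small_onto mu (prod c range) mu
      (fun p => iota (fun z => z ∈ dom (app e (k (pr1 p))) /\
                               app (app e (k (pr1 p))) z = pr2 p))); [dfn | trivial | |].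
    + intros z Hz. destruct (Cq z Hz) as (i & Hi & L). destruct (Hk i Hi) as [K1 K2].
      assert (Hd : z ∈ dom (app e (k i))).
      { apply (ord_le_lt_trans _ (app q i)); trivial. apply (ordinal_mem mu); trivial.
        now apply family_dom. }
      exists (opair i (app (app e (k i)) z)). rewrite in_prod_opair, pr1_opair, pr2_opair.
      split; [auto using in_range|]. apply iota_unique; [auto|].
      intros y [Hy E]. now apply (family_app (k i) K1).
    + apply small_prod; trivial; [now apply small_mem | now exists w].
  - destruct (Smu w Hw Cw) as (y & (Oy & (Cy & Hwy) & _) & Hy).
    destruct (Hcof y Hy) as (i & Hi & K). apply (cardinal_not_card_le y w Cy Hwy).
    apply (card_le_trans _ range); trivial.
    assert (Hs : subset y (dom (app e i))).
    { intros z Hz. apply (ordinal_trans _ y); trivial. apply (ordinal_mem mu); trivial.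
      now apply family_dom. }
    apply (card_le_of _ _ (app (app e i))); [dfn|..].
    + intros z Hz. auto using in_range.
    + intros z z' Hz Hz'. apply (family_app i Hi); auto.
Qed.

(** With domains bounded by [a] and ranges of size [w], the injections are coded by
    functions from [t] to [t], for [t] the larger of [a + 1] and [w + 1]. *)
Lemma family_small (s : M) :
  singular mu \/ limit_cardinal mu ->
  is_ord_sup (hartogs_of_power_below mu) s -> ord_le s lam ->
  small lam (image lam (app e)).
Proof.
  intros Hmu Hs Hsl. destruct (family_dom_bounded Hmu) as (a & Ha & Ba).
  destruct range_cardinality as (w & Hw & Cw & Ew).
  apply equinumerous_card_le, card_le_app in Ew as (u & Mu & Iu).
  assert (Oa : ordinal a) by now apply (ordinal_mem mu).
  assert (Ow : ordinal w) by apply Cw.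
  set (t := cup (succ a) (succ w)).
  assert (Ht : t ∈ mu) by (apply cup_mem; auto using ordinal_succ; now apply Imu).
  assert (Dt : forall i, i ∈ lam -> subset (dom (app e i)) t).
  { intros i Hi z Hz. apply in_cup. left. apply in_succ. left.
    apply (ord_lt_le_trans _ (dom (app e i))); auto. }
  assert (Wt : w ∈ t) by (apply in_cup; right; apply in_succ; tauto).
  set (Fs := sep (pow (prod t t)) (fun f => is_function f t t)).
  assert (HFs : is_function_set t t Fs).
  { intro f. unfold Fs. rewrite in_sep by dfn. rewrite in_pow. split; [tauto|].
    intro Hf. split; trivial. intros p Hp.
    destruct (proj1 Hf p Hp) as (x & y & Hx & Hy & E). apply is_opair_iff in E. subst p.
    now apply in_prod_opair. }
  destruct (ex_hartogs Fs) as [h Hh].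
  assert (Hhs : ord_le h s) by (apply Hs; now exists t, Fs).
  assert (Wo : well_orderable (image lam (app e))).
  { exists lam. split; trivial. apply card_le_image; [dfn|]. now apply well_orderable_ordinal. }
  destruct (well_orderable_cardinality _ Wo) as (k & Ck & Ek).
  exists k. split; [|now apply equinumerous_card_le].
  apply (ord_lt_le_trans _ h); trivial; [|now apply (ord_le_trans h s)].
  apply (lt_hartogs Fs h); trivial; [apply Ck|].
  apply (card_le_trans _ (image lam (app e))); [now apply equinumerous_card_le, equinumerous_sym|].
  (* The value [w], which no element of the range is sent to, marks the points outside
     the domain. *)
  set (v := fun g z => ite (z ∈ dom g) (app u (app g z)) w).
  assert (Dv : forall g, DefTerm (fun c : unit * M => v g (snd c))) by (intro; unfold v; dfn).
  assert (Hv : forall i z, i ∈ lam -> z ∈ dom (app e i) ->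
    v (app e i) z = app u (app (app e i) z) /\ v (app e i) z ∈ w).
  { intros i z Hi Hz. unfold v. rewrite ite_true; auto using in_range. }
  assert (Nv : forall g z, ~ z ∈ dom g -> v g z = w) by (intros; now apply ite_false).
  apply (card_le_of _ _ (fun g => graph t (v g))); [unfold graph, v; dfn|..].
  - intros g Hg. rewrite in_image in Hg by dfn. destruct Hg as (i & Hi & ->).
    apply HFs, graph_function; [apply Dv|]. intros z Hz.
    destruct (classic (z ∈ dom (app e i))) as [C|C].
    + apply in_cup. right. apply in_succ. left. now apply Hv.
    + now rewrite Nv.
  - intros g g' Hg Hg' E. rewrite in_image in Hg, Hg' by dfn.
    destruct Hg as (i & Hi & ->), Hg' as (j & Hj & ->).
    assert (Ev : forall z, z ∈ t -> v (app e i) z = v (app e j) z).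
    { intros z Hz.
      assert (K : app (graph t (v (app e i))) z = app (graph t (v (app e j))) z)
        by now rewrite E.
      now rewrite (app_graph t (v (app e i)) z (Dv _) Hz),
        (app_graph t (v (app e j)) z (Dv _) Hz) in K. }
    assert (D : forall i j, i ∈ lam -> j ∈ lam ->
      (forall z, z ∈ t -> v (app e i) z = v (app e j) z) ->
      subset (dom (app e i)) (dom (app e j))).
    { clear - Hv Nv Dt. intros i j Hi Hj Ev z Hz. apply NNPP. intro N.
      assert (K := proj2 (Hv i z Hi Hz)). rewrite Ev, Nv in K; trivial.
      - now apply (mem_irrefl w).
      - now apply (Dt i Hi). }
    assert (Ed : dom (app e i) = dom (app e j)).
    { apply set_ext. intro z. split; apply D; trivial. intros y Hy. symmetry. auto. }
    apply (function_ext _ _ (dom (app e i)) X X).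
    + now apply (in_injections_below mu X), He.
    + rewrite Ed. now apply (in_injections_below mu X), He.
    + intros z Hz. assert (Hz' := Hz). rewrite Ed in Hz'.
      assert (L := Ev z (Dt i Hi z Hz)).
      rewrite (proj1 (Hv i z Hi Hz)), (proj1 (Hv j z Hj Hz')) in L.
      apply Iu; auto using in_range.
Qed.

End Families.

Theorem pairs_below_injections (X mu lam s c : M) :
  is_hartogs X mu -> singular mu \/ limit_cardinal mu -> cardinal lam ->
  is_ord_sup (hartogs_of_power_below mu) s -> ord_le s lam ->
  is_cf mu c -> is_cf lam c ->
  exists Y lY lam_plus I lI : M,
    is_hartogs Y lam /\ is_lindenbaum Y lY /\ is_card_succ lam lam_plus /\
    is_injections_below mu X I /\ is_lindenbaum I lI /\ is_card_prod lI lam_plus lY.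
Proof.
  intros HX Hmu Clam Hs Hsl Hcm Hcl.
  assert (Imu : infinite_cardinal mu).
  { destruct Hmu; [now apply singular_infinite | now apply limit_cardinal_infinite]. }
  assert (Omu : ordinal mu) by apply Imu. assert (Olam : ordinal lam) by apply Clam.
  assert (Ilam : infinite_cardinal lam).
  { split; trivial. apply (limit_of_cf lam c); trivial. apply (one_lt_cf mu); trivial. apply Imu. }
  destruct (ex_lindenbaum (injections_below mu X)) as [lI HlI].
  destruct (cf_cofinal mu c Hcm) as (qm & Mm & Cm).
  destruct (cf_cofinal lam c Hcl) as (ql & Ml & Cl).
  (* [d a] is the supremum of the values of the cofinal map [ql] on the initial segment
     of those [j] before which [qm] stays below [a]; so [d] is monotone, and cofinal
     since [qm] is bounded on each proper initial segment of [c]. *)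
  set (D := fun a => sep c (fun j => forall i, i ∈ j -> app qm i ∈ a)).
  assert (HD : forall a j, j ∈ D a <-> j ∈ c /\ forall i, i ∈ j -> app qm i ∈ a).
  { intros a j. unfold D. now rewrite in_sep by dfn. }
  set (d := fun a => union (image (D a) (app ql))).
  assert (Dd : DefTerm (fun c : unit * M => d (snd c))) by (unfold d, D; dfn).
  assert (Hel : forall a y, y ∈ image (D a) (app ql) -> y ∈ lam).
  { intros a y Hy. rewrite in_image in Hy by dfn. destruct Hy as (j & Hj & ->).
    apply HD in Hj as [Hj _]. auto. }
  assert (Oel : forall a y, y ∈ image (D a) (app ql) -> ordinal y).
  { intros a y Hy. apply (ordinal_mem lam); eauto. }
  assert (Md : forall a, a ∈ mu -> d a ∈ lam).
  { intros a Ha. destruct (Cm a Ha) as (j0 & H0 & K0).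
    destruct (cf_bounded lam c j0 (app ql)) as (z & Hz & Bz); trivial; [dfn | |].
    { intros j Hj. apply Ml. apply (ordinal_trans c j0); trivial. apply Hcl. }
    assert (O1 : ordinal z) by now apply (ordinal_mem lam).
    assert (O2 : ordinal (app ql j0)) by (apply (ordinal_mem lam); auto).
    apply (ord_le_lt_trans _ (cup z (app ql j0))); trivial; [|apply cup_mem; auto].
    apply union_ord_le; [apply Oel | now apply ordinal_cup |].
    intros y Hy. rewrite in_image in Hy by dfn. destruct Hy as (j & Hj & ->).
    apply HD in Hj as [Hj Kj].
    destruct (ordinal_trichotomy j j0) as [C|[C|C]].
    - apply (ordinal_mem c); trivial. apply Hcl.
    - apply (ordinal_mem c); trivial. apply Hcl.
    - left. apply in_cup. auto.
    - subst. now apply ord_le_cup_r.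
    - destruct (ord_le_not_lt _ _ K0). auto. }
  assert (mono_d : forall a b, ord_le a b -> b ∈ mu -> ord_le (d a) (d b)).
  { intros a b Hab Hb. apply union_ord_le; [apply Oel | apply ordinal_union, Oel |].
    intros y Hy. apply ord_le_union; [apply Oel|]. rewrite in_image in Hy |- * by dfn.
    destruct Hy as (j & Hj & ->). exists j. split; trivial. apply HD in Hj as [Hj Kj].
    apply HD. split; trivial. intros i Hi. apply (ord_lt_le_trans _ a); auto.
    now apply (ordinal_mem mu). }
  destruct (pairs_below (injections_below mu X) lam lI (fun g => d (dom g)))
    as (Y & lY & lp & H1 & H2 & H3 & H4); trivial.
  - dfn.
  - intros g Hg. apply Md. now apply (in_injections_below mu X).
  - intros a Ha. destruct (Cl a Ha) as (j & Hj & K).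
    destruct (cf_bounded mu c j (app qm)) as (z & Hz & Bz); trivial; [dfn | |].
    { intros i Hi. apply Mm. apply (ordinal_trans c j); trivial. apply Hcm. }
    assert (L := Hz). apply (lt_hartogs X mu) in L; trivial; [|now apply (ordinal_mem mu)].
    destruct L as [g Hg]. exists g. split.
    + apply injections_below_spec; trivial. eauto.
    + rewrite (dom_function g z X (proj1 Hg)).
      apply (ord_le_trans _ (app ql j)); trivial; [apply ordinal_union, Oel|].
      apply ord_le_union; [apply Oel|]. rewrite in_image by dfn. exists j.
      rewrite HD. auto.
  - intros e He. split; [now apply (family_small X mu lam e HX Imu Ilam He s)|].
    destruct (family_dom_bounded X mu lam e HX Imu Ilam He Hmu) as (a & Ha & Ba).
    exists (d a). split; auto.
  - exists Y, lY, lp, (injections_below mu X), lI.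
    exact (conj H1 (conj H2 (conj H3 (conj (injections_below_spec mu X Omu) (conj HlI H4))))).
Qed.

End Main.

Theorem theorem1p7 (M : set_structure) (HM : ZF M) :
  (* (a) *)
  (forall X lam hX lX c : M,
     is_hartogs X hX ->
     is_lindenbaum X lX ->
     cardinal lam ->
     is_cf lam c ->
     ord_le hX c ->
     c ∈ lX ->
     exists Y lY lam_plus : M,
       is_hartogs Y lam /\
       is_lindenbaum Y lY /\
       is_card_succ lam lam_plus /\
       is_card_prod lX lam_plus lY)
  /\
  (* (b) *)
  (forall X mu lam s c : M,
     is_hartogs X mu ->
     singular mu \/ limit_cardinal mu ->
     cardinal lam ->
     is_ord_sup (hartogs_of_power_below mu) s ->
     ord_le s lam ->
     is_cf mu c ->
     is_cf lam c ->
     exists Y lY lam_plus I lI : M,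
       is_hartogs Y lam /\
       is_lindenbaum Y lY /\
       is_card_succ lam lam_plus /\
       is_injections_below mu X I /\
       is_lindenbaum I lI /\
       is_card_prod lI lam_plus lY).
Proof. split; [exact pairs_below_surjection | exact pairs_below_injections]. Qed.
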